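(* Let $k$ be a field, $R=k[x,y]$, let $d\le j$ be positive integers, let $H$ be an acceptable $O$-sequence for $(d,j)$, and let $V\subset R_j$ be a $d$-dimensional subspace with $H(R/\overline V)=H$; write $I=\overline V$, $\tau=e_j+1$, and let $A=(a_1\ge\cdots\ge a_\tau)$, $B=(b_1\ge\cdots\ge b_{\tau-1})$, $C$, $D$ be the associated partitions. Suppose first $c_H=\lim_{i\to\infty}H_i=0$. Then $R/\overline V$, $R/L(V)$, $R/(V)$ have minimal graded resolutions of the form $$0\to\bigoplus_{i=1}^{\tau-1}R(-j-1-b_i)\to\bigoplus_{i=1}^{\tau}R(-j-1+a_i)\to R\to R/\overline V\to0,$$ $$0\to R(-j-2)^{j+1-d}\oplus 0\to\bigoplus_{i=1}^{\tau}R(-j-1+a_i)\oplus R(-j-1)^{j+2-d-\tau}\to R\to R/L(V)\to0,$$ $$0\to\bigoplus_{i=1}^{\tau-1}R(-j-1-b_i)\oplus R(-j-1)^{d-\tau}\to R(-j)^d\to R\to R/(V)\to0.$$ We have $\sum_{i=1}^\tau a_i=d$, each $a_i\ge1$, and $A$ has dual partition $A^\ast=(\tau,\tau(R_{-1}V),\tau(R_{-2}V),\ldots)$ of $d$, with $a_i^\ast=\tau(R_{-i+1}V)=e_{j+1-i}+1$. Also $\sum_{i=1}^{\tau-1}b_i=j+1-d$, each $b_i\ge1$, and $B$ has dual partition $B^\ast=(e_{j+1},e_{j+2},\ldots)$ of $j+1-d$, with $b_i^\ast=e_{j+i}$. For $i\ge0$ (with $i\le j$ in the first formula), $$\dim I_{j-i}=\sum_u|a_u-i|^+,\qquad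 H_{j+i}=\sum_u|b_u-i|^+.$$ Likewise $C$ has dual partition $C^\ast=(j+2-d,\tau(V),\tau(R_{-1}V),\tau(R_{-2}V),\ldots)$, a partition of $j+2$, and $D$ has dual partition $D^\ast=(d-1,e_{j+1},e_{j+2},\ldots)$, a partition of $j$. When $c_H>0$, $A$ satisfies $\sum_{i=1}^\tau a_i=d$, each $a_i\ge 1$, $A$ has dual partition $A^\ast=(\tau,\tau(R_{-1}V),\tau(R_{-2}V),\ldots)$ of $d$, with $a^\ast_i=\tau(R_{-i+1}V)=e_{j+1-i}+1$, and $\dim I_{j-i}=\sum_u|a_u-i|^+$ for $0\le i\le j$; $B$ is a partition of $j+1-d-c_H$ into $\tau-1$ parts with $b_i^\ast=e_{j+i}$, and $H_{j+i}=c_H+\sum_u|b_u-i|^+$ for $i\ge0$; and $C^\ast=(j+2-d,\tau(V),\tau(R_{-1}V),\ldots)$, $D^\ast=(d-1,e_{j+1},e_{j+2},\ldots)$.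
   Context: $R=k[x,y]$ has the standard grading, $M=(x,y)$; $R_i$ is the space of degree-$i$ forms. For a subspace $V\subset R_j$ and $i\ge0$, $R_iV=\mathrm{span}\{hf: h\in R_i, f\in V\}\subset R_{i+j}$ and $R_{-i}V=\{f\in R_{j-i}: R_i f\subset V\}$. $(V)$ is the ideal generated by $V$; the ancestor ideal is $\overline V=(V)\oplus R_{-1}V\oplus\cdots\oplus R_{-j}V$; the level ideal is $L(V)=\overline V+M^{j+1}$. $\tau(V)=\dim_kR_1V-\dim_kV$. $H(A)_i=\dim_k A_i$. $|n|^+=\max(n,0)$. A proper $O$-sequence is a sequence $H=(1,2,\ldots,\mu,H_\mu,H_{\mu+1},\ldots)$ of non-negative integers with $\mu=\min\{i: H_i<i+1\}$ a positive integer, $\mu\ge H_\mu\ge H_{\mu+1}\ge\cdots$, and $c_H=\lim_{i\to\infty} H_i$. Put $e_i=H_{i-1}-H_i$ ($i\ge1$), $e_0=-1$. $H$ is acceptable for $(d,j)$ if: $e_i\le e_{i+1}$ for $0\le i\le j$; $e_i\ge e_{i+1}$ for $i\ge j$; $\sum_{0\le i\le j}(e_i+1)=d$; $\sum_{i>j}e_i=(j+1-d)-c_H$; and $0\le e_j=e_{j+1}\le\min\{j+1-d,d-1\}$. Definition of the partitions: when $c_H=0$, $A$ and $B$ are defined by writing the generator degrees of $\overline V$ as $j+1-a_i$ and the degrees of its minimal relations as $j+1+b_i$. When $c_H>0$, let $f$ be a greatest common divisor of $V$ (of degree $c_H$) and define $A,B$ in the same way from the minimal resolution of the ancestor ideal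 of $V:f=\{g: fg\in V\}\subset R_{j-c_H}$, with $j-c_H$ in place of $j$. $C$ is the partition consisting of $a_1+1,\ldots,a_\tau+1$ together with $j+2-d-\tau$ parts equal to $1$; $D$ is the partition consisting of $b_1+1,\ldots,b_{\tau-1}+1$ together with $d-\tau$ parts equal to $1$. The dual partition $A^\ast$ of $A$ has $a^\ast_i=\#\{u:a_u\ge i\}$ (trailing zeros ignored). *)

(* Defs.v *)
From HB Require Import structures.
From mathcomp Require Import all_boot all_order all_algebra.
From mathcomp.multinomials Require Export mpoly.

Set Implicit Arguments.
Unset Strict Implicit.
Unset Printing Implicit Defensive.

Import Order.TTheory GRing.Theory Num.Theory.
Local Open Scope ring_scope.

Notation poly2 k := {mpoly k[2]}.
Notation Rform k t := (dhomog 2 k t).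

Section Forms.
Variable k : fieldType.

(* Multiplication by a form [h] of degree [t - s], from [R_s] to [R_t]; see
   [mulformE].  It is meaningless if [h] does not have degree [t - s]. *)
Definition mulform (s t : nat) (h : poly2 k) : 'Hom(Rform k s, Rform k t) :=
  linfun (fun f : Rform k s => indhomog t (h * (f : poly2 k))).

Variable j : nat.

(* [R_{t-j} V] for [t >= j]; see [Rspan_minimal]. *)
Definition Rspan (V : {vspace Rform k j}) (t : nat) : {vspace Rform k t} :=
  (\sum_(h <- vbasis {: Rform k (t - j)}) (mulform j t h @: V))%VS.

(* [R_{t-j} V] for [t <= j], the colon space; see [mem_Rcolon]. *)
Definition Rcolon (V : {vspace Rform k j}) (t : nat) : {vspace Rform k t} :=
  (\bigcap_(h <- vbasis {: Rform k (j - t)}) (mulform t j h @^-1: V))%VS.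

(* The subspace [R_{t-j} V] of [R_t], for every degree [t]; it is indexed by
   the degree [t] where it lives, so that [R_i V] is [RV V (j + i)], and
   [R_{-i} V] is [RV V (j - i)] for [i <= j]. *)
Definition RV (V : {vspace Rform k j}) (t : nat) : {vspace Rform k t} :=
  if (t < j)%N then Rcolon V t else Rspan V t.

Definition tauV (V : {vspace Rform k j}) : int :=
  (\dim (RV V j.+1))%:Z - (\dim V)%:Z.

Definition gideal := forall t : nat, {vspace Rform k t}.

Definition in_gideal (I : gideal) (p : poly2 k) : Prop :=
  forall t, indhomog t (pihomog mdeg t p) \in I t.

(* [H(R/I)_t] *)
Definition hilb_quot (I : gideal) (t : nat) : nat :=
  (\dim {: Rform k t} - \dim (I t))%N.

Definition gen_ideal (V : {vspace Rform k j}) : gideal :=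
  fun t => if (j <= t)%N then RV V t else 0%VS.

(* [(V)] in degrees [>= j], and [R_{-i} V] in degree [j - i]. *)
Definition ancestor (V : {vspace Rform k j}) : gideal :=
  fun t => if (j <= t)%N then gen_ideal V t else RV V t.

Definition maxpow (n : nat) : gideal :=
  fun t => if (n <= t)%N then fullv else 0%VS.

Definition level_ideal (V : {vspace Rform k j}) : gideal :=
  fun t => (ancestor V t + maxpow j.+1 t)%VS.

Definition mdvd (p q : poly2 k) : Prop := exists r, q = r * p.

Definition is_gcd (f : poly2 k) (V : {vspace Rform k j}) : Prop :=
  (forall v, v \in V -> mdvd f v) /\
  (forall h, (forall v, v \in V -> mdvd h v) -> mdvd h f).

(* [V : f], for a form [f] of degree [c <= j] *)
Definition colon_form (c : nat) (f : poly2 k) (V : {vspace Rform k j}) :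
    {vspace Rform k (j - c)} :=
  (mulform (j - c) j f @^-1: V)%VS.

End Forms.

Section Resolutions.
Variable k : fieldType.

(* Homogeneous of degree [z]; only [0] is homogeneous of negative degree. *)
Definition zhomog (z : int) (p : poly2 k) : bool :=
  if z is Posz n then p \is n.-homog else p == 0.

(* [0 -> \oplus_i R(-S_i) -> \oplus_l R(-G_l) -> I -> 0] is exact and
   homogeneous of degree 0.  Elements of the free modules are row vectors, on
   which the maps act by right multiplication by [phi] and [g]. *)
Record graded_res (I : gideal k) (G S : seq int)
    (g : 'cV[poly2 k]_(size G)) (phi : 'M[poly2 k]_(size S, size G)) : Prop :=
  GradedRes {
    res_gen_deg : forall l : 'I_(size G), zhomog G`_l (g l 0);
    res_rel_deg : forall (i : 'I_(size S)) (l : 'I_(size G)), zhomog (S`_i - G`_l) (phi i l);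
    res_gen : forall p, in_gideal I p <-> exists u, u *m g = p%:M;
    res_rel : forall u : 'rV_(size G), u *m g = 0 <-> exists w, u = w *m phi;
    res_inj : forall w : 'rV_(size S), w *m phi = 0 -> w = 0
  }.

(* All entries lie in the maximal ideal [(x, y)]. *)
Definition minimal_mx m n (A : 'M[poly2 k]_(m, n)) : Prop :=
  forall i l, (A i l)@_0%MM = 0.

(* The minimal resolution of the module [I]. *)
Definition min_res_ideal (I : gideal k) (G S : seq int) : Prop :=
  exists g phi, @graded_res I G S g phi /\ minimal_mx phi.

(* The minimal resolution
   [0 -> \oplus_i R(-S_i) -> \oplus_l R(-G_l) -> R -> R/I -> 0]. *)
Definition min_res_quot (I : gideal k) (G S : seq int) : Prop :=
  exists g phi, [/\ @graded_res I G S g phi, minimal_mx phi & minimal_mx g].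

End Resolutions.

Definition proper_Oseq (H : nat -> nat) : Prop :=
  exists mu : nat,
    [/\ (0 < mu)%N,
        forall i, (i < mu)%N -> H i = i.+1,
        (H mu <= mu)%N
      & forall i, (mu <= i)%N -> (H i.+1 <= H i)%N].

Definition seq_limit (H : nat -> nat) (c : nat) : Prop :=
  exists N, forall i, (N <= i)%N -> H i = c.

(* [e_i = H_{i-1} - H_i], where [e_0 = -1] *)
Definition eH (H : nat -> nat) (i : nat) : int :=
  if i is i'.+1 then (H i')%:Z - (H i)%:Z else -1.

(* [c] stands for the limit of [H]. *)
Record acceptable (d j c : nat) (H : nat -> nat) : Prop := Acceptable {
  acc_Oseq : proper_Oseq H;
  acc_lim : seq_limit H c;
  acc_incr : forall i, (i <= j)%N -> eH H i <= eH H i.+1;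
  acc_decr : forall i, (j <= i)%N -> eH H i.+1 <= eH H i;
  acc_sum_le : \sum_(0 <= i < j.+1) (eH H i + 1) = d%:Z;
  (* the infinite sum has finitely many nonzero terms *)
  acc_sum_gt : exists N, forall n, (N <= n)%N ->
    \sum_(j.+1 <= i < n) eH H i = (j.+1%:Z - d%:Z) - c%:Z;
  acc_ge0 : 0 <= eH H j;
  acc_eq : eH H j = eH H j.+1;
  acc_le : eH H j <= Num.min (j.+1%:Z - d%:Z) (d%:Z - 1)
}.

(* The dual partition, without trailing zeros. *)
Definition dualp (A : seq nat) : seq nat :=
  [seq count (fun a => (i <= a)%N) A | i <- iota 1 (\max_(a <- A) a)].

(* The part [s_i], with parts numbered from 1, and [s_i = 0] for [i > size s]. *)
Definition part (s : seq nat) (i : nat) : nat := nth 0%N s i.-1.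

Definition gen_degs (j : nat) (A : seq nat) : seq int :=
  [seq j.+1%:Z - a%:Z | a <- A].

Definition rel_degs (j : nat) (B : seq nat) : seq int :=
  [seq j.+1%:Z + b%:Z | b <- B].

Definition assoc_partitions (k : fieldType) (j c : nat)
    (V : {vspace Rform k j}) (A B : seq nat) : Prop :=
  [/\ sorted geq A, sorted geq B &
    if c == 0%N then
      min_res_ideal (ancestor V) (gen_degs j A) (rel_degs j B)
    else
      exists f, [/\ is_gcd f V, f \is c.-homog &
        min_res_ideal (ancestor (colon_form c f V))
          (gen_degs (j - c) A) (rel_degs (j - c) B)]].

Definition partC (d j tau : nat) (A : seq nat) : seq nat :=
  map succn A ++ nseq (j.+2 - d - tau) 1%N.

Definition partD (d tau : nat) (B : seq nat) : seq nat :=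
  map succn B ++ nseq (d - tau) 1%N.

Section Facts.
Variable k : fieldType.

Lemma mulformE s t (h : poly2 k) (f : Rform k s) :
  (s <= t)%N -> h \is (t - s).-homog ->
  mulform s t h f = h * (f : poly2 k) :> poly2 k.
Proof.
move=> le_st hh.
have hg (g : Rform k s) : h * (g : poly2 k) \is t.-homog.
  by have := dhomogM hh (dhomog_is_dhomog g); rewrite subnK.
have prodE (g : Rform k s) :
    indhomog t (h * (g : poly2 k)) = h * (g : poly2 k) :> poly2 k.
  exact: (insubdK (0 : Rform k t) (hg g)).
have lin : linear (fun g : Rform k s => indhomog t (h * (g : poly2 k))).
  move=> a u v; apply: val_inj; rewrite /= !prodE; etransitivity.
    exact: prodE (a *: u + v).
  by rewrite mulrDr -scalerAr.
have Lin := GRing.isLinear.Build _ _ _ _ _ lin.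
pose F : {linear Rform k s -> Rform k t} :=
  HB.pack (fun g : Rform k s => indhomog t (h * (g : poly2 k))) Lin.
by rewrite /mulform (lfunE F) /= prodE.
Qed.

Lemma mulform_lin s t (f : Rform k s) : (s <= t)%N ->
  linear (fun h : Rform k (t - s) => mulform s t h f).
Proof.
move=> le_st a u v; apply: val_inj => /=.
have E (h : Rform k (t - s)) := mulformE f le_st (dhomog_is_dhomog h).
rewrite !E; etransitivity; first exact: E (a *: u + v).
by rewrite mulrDl -scalerAl.
Qed.

Lemma Rspan_minimal j (V : {vspace Rform k j}) t (U : {vspace Rform k t}) :
  (j <= t)%N ->
  (Rspan V t <= U)%VS <->
  forall (h : Rform k (t - j)) f, f \in V -> mulform j t h f \in U.
Proof.
move=> le_jt; split=> [/subvP sU h f fV | HU].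
  have Lin := GRing.isLinear.Build _ _ _ _ _ (mulform_lin f le_jt).
  pose F : {linear Rform k (t - j) -> Rform k t} :=
    HB.pack (fun h : Rform k (t - j) => mulform j t h f) Lin.
  rewrite (coord_vbasis (memvf h)) -[mulform _ _ _ _]/(F _) linear_sum.
  apply: memv_suml => i _; rewrite linearZ memvZ //; apply: sU.
  have hi: (vbasis {: Rform k (t - j)})`_i \in vbasis {: Rform k (t - j)}.
    by rewrite mem_nth // size_tuple.
  rewrite /Rspan (big_rem _ hi) /=.
  by apply: (subvP (addvSl _ _)); apply: memv_img.
rewrite /Rspan big_tnth; apply/subv_sumP => i _.
apply/subvP => _ /memv_imgP[f fV ->].
exact: HU.
Qed.

Lemma mem_Rcolon j (V : {vspace Rform k j}) t (f : Rform k t) :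
  (t <= j)%N ->
  f \in Rcolon V t <-> forall h : Rform k (j - t), mulform t j h f \in V.
Proof.
move=> le_tj; split=> [fV h | HV]; last first.
  rewrite /Rcolon; elim/big_ind: _ => [|U W fU fW|h _];
    rewrite ?memvf -?memv_preim //.
  by rewrite memv_cap fU.
have Lin := GRing.isLinear.Build _ _ _ _ _ (mulform_lin f le_tj).
pose F : {linear Rform k (j - t) -> Rform k j} :=
  HB.pack (fun h : Rform k (j - t) => mulform t j h f) Lin.
rewrite (coord_vbasis (memvf h)) -[mulform _ _ _ _]/(F _) linear_sum.
apply: memv_suml => i _; rewrite linearZ memvZ //.
have hi: (vbasis {: Rform k (j - t)})`_i \in vbasis {: Rform k (j - t)}.
  by rewrite mem_nth // size_tuple.
move: fV; rewrite /Rcolon (big_rem _ hi) /= memv_cap => /andP[fV _].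
by rewrite memv_preim.
Qed.

End Facts.

(* Main.v *)
(** The key point is a saturation argument.  Let homogeneous vectors be the rows of
    [M], none redundant modulo the others, and suppose that [q] lies in the span of
    the rows as soon as [x q] and [y q] do.  Then the rows are free: a relation has
    no constant coefficients, so it is [x w' + y w''], and [x (w' M) = - y (w'' M)]
    forces [w' M = y q], [w'' M = - x q], with [q = c M]; the relations [w' - y c] and
    [w'' + x c] have smaller degree.  This gives both the length of minimal
    resolutions over [k[x, y]] (syzygy modules are saturated) and the shape of that
    of the ancestor ideal, which is saturated in degrees [< j] by construction: its
    relations have degree [> j+1].  The degrees in the resolutions, hence the
    partitions, are then determined by the dimensions of the graded pieces, with
    [dim R_1 W + dim R_{-1} W = 2 dim W] computing [tau].  The same identity shows
    that [dim R_1 W = dim W + 1] only if [W = f R_n]; applied to [R_i V] for large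
    [i], this produces the greatest common divisor when [c > 0], and multiplication
    by it reduces that case to one with [c = 0]. *)

(* Finite generation does not come from Noetherianity but from the ideal containing all forms of
   large degree. For the ancestor ideal this holds exactly when c = 0, which is why the case c > 0
   passes to V : f instead of being resolved directly. The Hilbert function only sees the number of
   generators minus the number of relations in each degree. It becomes decisive through a gap:
   generators of the ancestor ideal have degree at most j, since R_1 produces everything above,
   while relations have degree at least j + 2. The other two resolutions are separated likewise: all
   relations of L(V) have degree j + 2, and all generators of (V) have degree j. A and B come from
   an arbitrary minimal resolution of the prescribed shape, so 1 ≤ a ≤ j + 1 and b ≥ 1 must be
   proved before the degrees can be handled by truncated subtraction. *)
From HB Require Import structures.
Require Import Defs.
From mathcomp Require Import all_boot all_order all_algebra all_fingroup.
From mathcomp Require Import zify ring.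
From Stdlib Require Import Classical.

Set Implicit Arguments.
Unset Strict Implicit.
Unset Printing Implicit Defensive.

Import Order.TTheory GRing.Theory Num.Theory.
Local Open Scope ring_scope.

(** * Polynomials in two variables *)

Section TwoVariables.
Variable k : fieldType.
Implicit Types p q a b h : poly2 k.

Lemma ord2P (i : 'I_2) : i = 0 \/ i = 1.
Proof. by case: i => [[|[|]]] // lt; [left | right]; apply: val_inj. Qed.

Lemma mnm2P (m m' : 'X_{1..2}) : m 0 = m' 0 -> m 1 = m' 1 -> m = m'.
Proof.
move=> e0 e1; apply/mnmP => i.
by case: (ord2P i) => ->; [exact: e0 | exact: e1].
Qed.

Lemma X_neq0 (i : 'I_2) : ('X_i : poly2 k) != 0.
Proof.
by apply/eqP => /mpolyP /(_ U_(i)%MM); rewrite mcoeffX mcoeff0 eqxx => /eqP;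
  rewrite oner_eq0.
Qed.

Lemma X_dhomog (i : 'I_2) : ('X_i : poly2 k) \is 1.-homog.
Proof. by rewrite dhomogX; apply/eqP; exact: mdeg1. Qed.

Lemma dhomogXM (i : 'I_2) t p : p \is t.-homog -> 'X_i * p \is t.+1.-homog.
Proof. exact: (dhomogM (X_dhomog i)). Qed.

Lemma mcoeff_mulX0 (i : 'I_2) p (m : 'X_{1..2}) : m i = 0%N -> ('X_i * p)@_m = 0.
Proof.
move=> m0; rewrite mcoeffM big1 // => -[u v] /= /eqP uv.
rewrite mcoeffX; case: eqP => [|_]; last by rewrite mul0r.
move/mnmP=> /(_ i) ui.
by have := congr1 (fun w : 'X_{1..2} => w i) uv; rewrite mnmDE -ui m0 mnm1E eqxx.
Qed.

Lemma mpolyX_divX (i : 'I_2) (m : 'X_{1..2}) : (0 < m i)%N ->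
  'X_[m] = 'X_i * 'X_[m - U_(i)] :> poly2 k.
Proof.
move=> mi; rewrite -mpolyXD addmC submK //; apply/mnm_lepP => l.
by rewrite mnm1E; case: eqP => // <-.
Qed.

Lemma nonconst_split p : p@_0%MM = 0 -> exists a b, p = 'X_0 * a + 'X_1 * b.
Proof.
move=> p0; rewrite (mpolyE p) big_seq.
elim/big_rec: _ => [|m r mp [a [b ->]]].
  by exists 0, 0; rewrite !mulr0 addr0.
have [m0|m0] := posnP (m 0); last first.
  eexists (a + _), b; rewrite (mpolyX_divX m0) scalerAr mulrDr.
  by rewrite addrC addrAC.
have [m1|m1] := posnP (m 1).
  have mE : m = 0%MM by apply: mnm2P; rewrite mnm0E.
  by move: mp; rewrite mE mcoeff_msupp p0 eqxx.
eexists a, (b + _); rewrite (mpolyX_divX m1) scalerAr mulrDr.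
by rewrite addrC addrA.
Qed.

(** Coprimality of x and y, read off coefficients, without unique factorization: a monomial of a
    free of y would give one of x a free of y, but x a = y b. *)
Lemma X_syzygy a b : 'X_0 * a = 'X_1 * b -> exists q, a = 'X_1 * q /\ b = 'X_0 * q.
Proof.
move=> ab.
have [q aE] : exists q, a = 'X_1 * q.
  rewrite (mpolyE a) big_seq; elim/big_rec: _ => [|m r ma [q ->]].
    by exists 0; rewrite mulr0.
  have [m1|m1] := posnP (m 1).
    move: ma; rewrite mcoeff_msupp -(mcoeffMX _ U_(0)) mulrC.
    by rewrite ab mcoeff_mulX0 ?eqxx // mnmDE m1 mnm1E.
  by eexists (_ + q); rewrite (mpolyX_divX m1) scalerAr mulrDr.
exists q; split=> //; apply: (mulfI (X_neq0 1)).
by rewrite -ab aE; ring.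
Qed.

Lemma pihomogM t s p h : h \is s.-homog ->
  pihomog mdeg (t + s) (p * h) = pihomog mdeg t p * h.
Proof.
move=> hh; have [K pK] : exists K, (t < K)%N /\ (mmeasure mdeg p <= K)%N.
  by exists (maxn t.+1 (mmeasure mdeg p)); rewrite leq_maxl leq_maxr.
case: pK => tK pK.
rewrite {1}(pihomog_partitionE pK) mulr_suml raddf_sum /=.
rewrite (bigD1 (Ordinal tK)) //= pihomog_dE; last exact: dhomogM (pihomogP _ _ _) hh.
rewrite big1 ?addr0 // => i ne_it.
apply: pihomog_ne0 (dhomogM (pihomogP _ _ _) hh).
by rewrite eqn_add2r; apply: contraNneq ne_it => e; apply/eqP/val_inj.
Qed.

Lemma pihomogM0 t s p h : h \is s.-homog -> (t < s)%N ->
  pihomog mdeg t (p * h) = 0.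
Proof.
move=> hh ts; rewrite (pihomog_partitionE (leqnn (mmeasure mdeg p))).
rewrite mulr_suml raddf_sum big1 //= => i _.
apply: pihomog_ne0 (dhomogM (pihomogP _ _ _) hh).
by rewrite gtn_eqF // ltn_addl.
Qed.

Lemma dhomog0E p : p \is 0.-homog -> p = (p@_0%MM)%:MP.
Proof.
move=> hp; apply/mpolyP => m; rewrite mcoeffC.
case: eqP => [->|/eqP m0]; first by rewrite mulr1.
by rewrite mulr0; apply: (dhomog_nemf_coeff hp); rewrite mdeg_eq0.
Qed.

Lemma dhomogS_const p t : p \is t.+1.-homog -> p@_0%MM = 0.
Proof. by move=> hp; apply: (dhomog_nemf_coeff hp); rewrite mf0. Qed.

Lemma pihomogX_mul t (i : 'I_2) p :
  pihomog mdeg t.+1 ('X_i * p) = 'X_i * pihomog mdeg t p.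
Proof. by rewrite !['X_i * _]mulrC -(pihomogM _ _ (X_dhomog i)) addn1. Qed.

Lemma dhomog_split t p : p \is t.+1.-homog ->
  exists a b, [/\ a \is t.-homog, b \is t.-homog & p = 'X_0 * a + 'X_1 * b].
Proof.
move=> hp; have [a [b pE]] := nonconst_split (dhomogS_const hp).
exists (pihomog mdeg t a), (pihomog mdeg t b); split; try exact: pihomogP.
rewrite -(pihomog_dE hp) pE raddfD /=.
by rewrite !pihomogX_mul.
Qed.

(** The product is its own component of degree t + s, which is h times the component of p of degree
    t; then h cancels. *)
Lemma mulf_dhomog t s p h : h != 0 -> h \is s.-homog -> p * h \is (t + s).-homog ->
  p \is t.-homog.
Proof.
move=> h0 hh hp; rewrite homog_piE; apply/eqP/(mulIf h0).
by rewrite -(pihomogM t p hh) pihomog_dE.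
Qed.

End TwoVariables.

(** * Spaces of forms *)

Section FormSpaces.
Variable k : fieldType.
Implicit Types p q a b h : poly2 k.

Lemma indhomogK t p : p \is t.-homog -> indhomog t p = p :> poly2 k.
Proof. exact: (insubdK (0 : Rform k t)). Qed.

Lemma indhomog_val t (f : Rform k t) : indhomog t (f : poly2 k) = f.
Proof. exact: (valKd (0 : Rform k t) f). Qed.

Lemma dim_Rform t : \dim {: Rform k t} = t.+1.
Proof. by rewrite dimvf [LHS](_ : _ = 'C(t + 1, t))%N // addn1 binSn. Qed.

Lemma dim_Rform_le t (U : {vspace Rform k t}) : (\dim U <= t.+1)%N.
Proof. by have := dimvS (subvf U); rewrite dim_Rform. Qed.

(** Membership for bare polynomials, so that forms of different degrees can be multiplied and
    compared without casts between the types [Rform k t]. The first conjunct matters because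
    [indhomog t] sends a non-homogeneous polynomial to 0, which lies in every U. *)
Definition pmem t (U : {vspace Rform k t}) p : bool :=
  (p \is t.-homog) && (indhomog t p \in U).

Lemma pmem_homog t (U : {vspace Rform k t}) p : pmem U p -> p \is t.-homog.
Proof. by case/andP. Qed.

Lemma pmem_val t (U : {vspace Rform k t}) (f : Rform k t) :
  pmem U (f : poly2 k) = (f \in U).
Proof. by rewrite /pmem dhomog_is_dhomog indhomog_val. Qed.

Lemma pmemP t (U : {vspace Rform k t}) p :
  reflect (exists2 f, f \in U & p = f :> poly2 k) (pmem U p).
Proof.
apply: (iffP andP) => [[hp pU]|[f fU ->]]; first by exists (indhomog t p); rewrite ?indhomogK.
by rewrite dhomog_is_dhomog indhomog_val.
Qed.

Lemma pmem0 t (U : {vspace Rform k t}) : pmem U 0.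
Proof. by apply/pmemP; exists 0; rewrite ?mem0v. Qed.

Lemma pmemD t (U : {vspace Rform k t}) p q : pmem U p -> pmem U q -> pmem U (p + q).
Proof.
by case/pmemP=> f fU -> /pmemP[g gU ->]; apply/pmemP; exists (f + g); rewrite ?memvD.
Qed.

Lemma pmemZ t (U : {vspace Rform k t}) c p : pmem U p -> pmem U (c *: p).
Proof. by case/pmemP=> f fU ->; apply/pmemP; exists (c *: f); rewrite ?memvZ. Qed.

Lemma pmem_full t p : pmem (fullv : {vspace Rform k t}) p = (p \is t.-homog).
Proof. by rewrite /pmem memvf andbT. Qed.

Lemma pmem_zero t p : pmem (0%VS : {vspace Rform k t}) p = (p == 0).
Proof.
apply/idP/eqP => [|->]; last exact: pmem0.
by case/pmemP=> f; rewrite memv0 => /eqP -> ->.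
Qed.

Lemma pmem_sub t (U W : {vspace Rform k t}) :
  (forall p, pmem U p -> pmem W p) <-> (U <= W)%VS.
Proof.
split=> [UW|/subvP UW p /andP[hp pU]]; last by rewrite /pmem hp UW.
by apply/subvP => f; rewrite -!pmem_val => /UW.
Qed.

Lemma pmem_eq t (U W : {vspace Rform k t}) : (forall p, pmem U p = pmem W p) -> U = W.
Proof. by move=> UW; apply/vspaceP => f; rewrite -!pmem_val UW. Qed.

Definition mulX (i : 'I_2) t : 'Hom(Rform k t, Rform k t.+1) := mulform t t.+1 'X_i.

Lemma mulformE_val s t (h : Rform k (t - s)) (f : Rform k s) : (s <= t)%N ->
  mulform s t h f = (h : poly2 k) * (f : poly2 k) :> poly2 k.
Proof. by move=> st; apply: mulformE => //; apply: dhomog_is_dhomog. Qed.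

Lemma mulXE i t (f : Rform k t) : mulX i t f = 'X_i * (f : poly2 k) :> poly2 k.
Proof. by apply: mulformE => //; rewrite subSnn X_dhomog. Qed.

Lemma mulX_inj i t : lker (mulX i t) == 0%VS.
Proof.
apply/lker0P => f g /(congr1 (fun h : Rform k _ => h : poly2 k)).
by rewrite !mulXE => /(mulfI (X_neq0 k i))/val_inj.
Qed.

Lemma dim_mulX i t U : \dim (mulX i t @: U) = \dim U.
Proof. by apply: limg_dim_eq; rewrite (eqP (mulX_inj i t)) capv0. Qed.

Lemma pmem_mulX i t U p :
  reflect (exists2 a, pmem U a & p = 'X_i * a) (pmem (mulX i t @: U) p).
Proof.
apply: (iffP (pmemP _ _)) => [[_ /memv_imgP[f fU ->] ->]|[a /pmemP[f fU ->] ->]].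
  by exists (f : poly2 k); rewrite ?pmem_val ?mulXE.
by exists (mulX i t f); rewrite ?memv_img ?mulXE.
Qed.

(** R_1 U through the two variables rather than a basis of R_1. Iterating it, and [R1colon]
    downwards, reaches every R_i V; see [RV_up] and [RV_down]. *)
Definition R1mul t (U : {vspace Rform k t}) : {vspace Rform k t.+1} :=
  (mulX 0 t @: U + mulX 1 t @: U)%VS.

Lemma pmem_addv t (U W : {vspace Rform k t}) p :
  reflect (exists a b, [/\ pmem U a, pmem W b & p = a + b]) (pmem (U + W)%VS p).
Proof.
apply: (iffP (pmemP _ _)) => [[_ /memv_addP[f fU [g gW ->]] ->]|].
  by exists (f : poly2 k), (g : poly2 k); rewrite !pmem_val.
case=> _ [_ [/pmemP[f fU ->] /pmemP[g gW ->] ->]].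
by exists (f + g); rewrite ?memv_add.
Qed.

Lemma pmem_R1mul t (U : {vspace Rform k t}) p :
  reflect (exists a b, [/\ pmem U a, pmem U b & p = 'X_0 * a + 'X_1 * b])
          (pmem (R1mul U) p).
Proof.
apply: (iffP (pmem_addv _ _ _)) => [[_ [_ [/pmem_mulX[a aU ->] /pmem_mulX[b bU ->] ->]]]|].
  by exists a, b.
case=> a [b [aU bU ->]]; exists ('X_0 * a), ('X_1 * b); split=> //.
  by apply/pmem_mulX; exists a.
by apply/pmem_mulX; exists b.
Qed.

Definition R1colon t (U : {vspace Rform k t.+1}) : {vspace Rform k t} :=
  (mulX 0 t @^-1: U :&: mulX 1 t @^-1: U)%VS.

Lemma pmem_R1colon t (U : {vspace Rform k t.+1}) p :
  pmem (R1colon U) p = [&& p \is t.-homog, pmem U ('X_0 * p) & pmem U ('X_1 * p)].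
Proof.
have [hp|hp] /= := boolP (p \is t.-homog); last by rewrite /pmem (negPf hp).
have -> : p = indhomog t p :> poly2 k by rewrite indhomogK.
by rewrite pmem_val memv_cap -!memv_preim -!mulXE !pmem_val.
Qed.

(** The sum xU + yU has dimension 2 dim U minus that of the intersection, and by [X_syzygy] the
    intersection of xU and yU is xy R_{-1} U. *)
Lemma dim_R1mul t (U : {vspace Rform k t.+1}) :
  (\dim (R1mul U) + \dim (R1colon U) = 2 * \dim U)%N.
Proof.
have := dimv_sum_cap (mulX 0 t.+1 @: U) (mulX 1 t.+1 @: U).
rewrite !dim_mulX addnn -mul2n => <-; congr (_ + _)%N.
rewrite -(dim_mulX 1 (R1colon U)) -(dim_mulX 0 (mulX 1 t @: R1colon U)).
suff -> : (mulX 0 t.+1 @: (mulX 1 t @: R1colon U) =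
  mulX 0 t.+1 @: U :&: mulX 1 t.+1 @: U)%VS by [].
apply: pmem_eq => p; apply/pmem_mulX/idP.
  case=> q /pmem_mulX[a]; rewrite pmem_R1colon => /and3P[_ a0 a1] -> ->.
  rewrite /pmem; apply/andP; split.
    by apply/dhomogXM/(pmem_homog a1).
  rewrite memv_cap -!pmem_val indhomogK; last first.
    by apply/dhomogXM/(pmem_homog a1).
  apply/andP; split; apply/pmem_mulX; last by exists ('X_0 * a); rewrite // mulrCA.
  by exists ('X_1 * a).
case/andP=> hp; rewrite memv_cap -!pmem_val indhomogK // => /andP[].
case/pmem_mulX=> a aU pa /pmem_mulX[b bU pb].
have /X_syzygy[q [aE bE]] : 'X_0 * a = 'X_1 * b by rewrite -pa.
exists a; last by rewrite pa.
apply/pmem_mulX; exists q; last by [].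
rewrite pmem_R1colon -aE -bE aU bU !andbT.
apply: (mulf_dhomog (X_neq0 k 0) (X_dhomog k 0)).
by rewrite addn1 mulrC -bE (pmem_homog bU).
Qed.

Lemma dim_R1mul0 (U : {vspace Rform k 0}) : \dim (R1mul U) = (2 * \dim U)%N.
Proof.
rewrite mul2n -addnn -{1}(dim_mulX 0 U) -(dim_mulX 1 U).
rewrite dimv_disjoint_sum //; apply/eqP; rewrite -subv0; apply/pmem_sub => p.
case/andP=> hp; rewrite memv_cap -!pmem_val indhomogK // => /andP[].
case/pmem_mulX=> a aU pa /pmem_mulX[b bU pb].
have /X_syzygy[q [aE bE]] : 'X_0 * a = 'X_1 * b by rewrite -pa.
rewrite pmem_zero pa (dhomog0E (pmem_homog aU)) aE mcoeff_mulX0 ?mnm0E //.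
by rewrite mpolyC0 mulr0.
Qed.

(** By [dim_R1mul] it suffices that R_{-1} U is smaller than U. If it is nonzero, induction makes it
    smaller than R_1 R_{-1} U, which lies in U. *)
Lemma dim_R1mul_gt t (U : {vspace Rform k t}) :
  (0 < \dim U)%N -> (\dim U < \dim (R1mul U))%N.
Proof.
elim: t U => [|t IH] U U0; first by rewrite dim_R1mul0; lia.
have e := dim_R1mul U.
have le : (\dim (R1mul (R1colon U)) <= \dim U)%N.
  apply/dimvS/pmem_sub => p /pmem_R1mul[a [b [aU bU ->]]].
  move: aU bU; rewrite !pmem_R1colon => /and3P[_ a0 _] /and3P[_ _ b1].
  exact: pmemD.
have := IH (R1colon U); lia.
Qed.

End FormSpaces.

(** * The spaces R_i V, one degree at a time *)

Section Ancestor.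
Variable k : fieldType.
Implicit Types p q a b h : poly2 k.
Variables (j : nat) (V : {vspace Rform k j}).

Lemma ancestorE t : ancestor V t = RV V t.
Proof. by rewrite /ancestor /gen_ideal; case: (j <= t)%N. Qed.

Lemma RV_id : RV V j = V.
Proof.
rewrite /RV ltnn; apply/eqP; rewrite eqEsubv; apply/andP; split.
  apply/(Rspan_minimal _ _ (leqnn j)) => h f fV.
  have hh : (h : poly2 k) \is (j - j).-homog by exact: dhomog_is_dhomog.
  rewrite -pmem_val mulformE_val //.
  move: (h : poly2 k) hh => g; rewrite subnn => /dhomog0E ->.
  by rewrite mul_mpolyC pmemZ // pmem_val.
apply/subvP => f fV; have [+ _] := Rspan_minimal V (Rspan V j) (leqnn j).
have h1 : (1 : poly2 k) \is (j - j).-homog by rewrite subnn dhomog1.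
move=> /(_ (subvv _)) /(_ (indhomog _ 1) f fV).
by rewrite -!pmem_val mulformE_val // (indhomogK h1) mul1r.
Qed.

Lemma pmem_RV_lower t p : (t <= j)%N ->
  pmem (RV V t) p <->
  p \is t.-homog /\ forall h, h \is (j - t).-homog -> pmem V (h * p).
Proof.
rewrite leq_eqVlt => /predU1P[->|tj].
  rewrite RV_id subnn; split=> [pV|[_ /(_ 1 (dhomog1 _ _))]]; last by rewrite mul1r.
  split=> [|h /dhomog0E ->]; first exact: pmem_homog pV.
  by rewrite mul_mpolyC pmemZ.
rewrite /RV tj; split=> [/andP[hp pV]|[hp pV]]; last first.
  rewrite /pmem hp; apply/(mem_Rcolon _ _ (ltnW tj)) => h.
  by rewrite -pmem_val mulformE_val ?(ltnW tj) // (indhomogK hp) pV //; apply: dhomog_is_dhomog.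
split=> // h hh.
have := proj1 (mem_Rcolon V (indhomog t p) (ltnW tj)) pV (indhomog _ h).
by rewrite -pmem_val mulformE_val ?(ltnW tj) // (indhomogK hp) (indhomogK hh).
Qed.

Lemma RV_down t : (t < j)%N -> RV V t = R1colon (RV V t.+1).
Proof.
move=> tj; apply: pmem_eq => p; rewrite pmem_R1colon.
have jt : (j - t)%N = (j - t.+1).+1 by lia.
apply/idP/and3P => [/(pmem_RV_lower _ (ltnW tj))[hp pV]|[hp pV0 pV1]].
  have aux i : pmem (RV V t.+1) ('X_i * p).
    apply/(pmem_RV_lower _ tj); split; first exact: dhomogXM.
    by move=> h hh; rewrite mulrA mulrAC mulrC mulrA pV // jt dhomogXM.
  by rewrite hp.
apply/(pmem_RV_lower _ (ltnW tj)); split=> // h; rewrite jt => /dhomog_split[a [b [ha hb ->]]].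
have -> : ('X_0 * a + 'X_1 * b) * p = a * ('X_0 * p) + b * ('X_1 * p) by ring.
case/(pmem_RV_lower _ tj): pV0 => _ /(_ _ ha) pa.
by case/(pmem_RV_lower _ tj): pV1 => _ /(_ _ hb); apply: pmemD.
Qed.

Lemma RV_up t : (j <= t)%N -> RV V t.+1 = R1mul (RV V t).
Proof.
move=> jt; have jt1 := leqW jt; rewrite /RV !ltnNge jt jt1 /=.
have jtE : (t.+1 - j)%N = (t - j).+1 by lia.
have mem_span s h f : (j <= s)%N -> h \is (s - j).-homog -> f \in V ->
    pmem (Rspan V s) (h * (f : poly2 k)).
  move=> js hh fV; have [+ _] := Rspan_minimal V (Rspan V s) js.
  move=> /(_ (subvv _)) /(_ (indhomog _ h) f fV).
  by rewrite -pmem_val mulformE_val // (indhomogK hh).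
apply/eqP; rewrite eqEsubv; apply/andP; split.
  apply/(Rspan_minimal _ _ jt1) => h f fV; rewrite -pmem_val mulformE_val //.
  have : (h : poly2 k) \is (t.+1 - j).-homog by exact: dhomog_is_dhomog.
  move: (h : poly2 k) => g; rewrite jtE => /dhomog_split[a [b [ha hb ->]]].
  apply/pmem_R1mul; exists (a * f), (b * f); split; last by ring.
    exact: mem_span.
  exact: mem_span.
have sub i : (mulX k i t @: Rspan V t <= Rspan V t.+1)%VS.
  suff /subvP sub : (Rspan V t <= mulX k i t @^-1: Rspan V t.+1)%VS.
    by apply/subvP => _ /memv_imgP[f /sub fU ->]; rewrite memv_preim.
  apply/(Rspan_minimal _ _ jt) => h f fV.
  rewrite -memv_preim -pmem_val mulXE mulformE_val // mulrA; apply: mem_span => //.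
  by rewrite jtE; exact/dhomogXM/dhomog_is_dhomog.
by rewrite subv_add !sub.
Qed.

Lemma RV_mulX t i p : pmem (RV V t) p -> pmem (RV V t.+1) ('X_i * p).
Proof.
case: (ltnP t j) => [tj|jt].
  rewrite (RV_down tj) pmem_R1colon => /and3P[_ p0 p1].
  by case: (ord2P i) => ->.
move=> pV; rewrite (RV_up jt); apply/pmem_addv.
have [->|->] := ord2P i.
  exists ('X_0 * p), 0; split; rewrite ?pmem0 ?addr0 //.
  by apply/pmem_mulX; exists p.
exists 0, ('X_1 * p); split; rewrite ?pmem0 ?add0r //.
by apply/pmem_mulX; exists p.
Qed.

End Ancestor.

(** * Homogeneous vectors *)

Section HomogeneousVectors.
Variable k : fieldType.
Local Notation P := (poly2 k).

(** Homogeneous elements of degree t of the sum of the R(-D_l). Without the test, truncation of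
    [t - D l] to 0 would let constants into the entries with D_l > t. *)
Definition hv n (D : 'I_n -> nat) t (u : 'rV[P]_n) : Prop :=
  forall l, if (D l <= t)%N then u 0 l \is (t - D l).-homog else u 0 l == 0.

Definition hcomp n (D : 'I_n -> nat) t (u : 'rV[P]_n) : 'rV[P]_n :=
  \row_l if (D l <= t)%N then pihomog mdeg (t - D l) (u 0 l) else 0.

Section OneModule.
Variables (n : nat) (D : 'I_n -> nat).
Implicit Types u v : 'rV[P]_n.

Lemma hv_hcomp t u : hv D t (hcomp D t u).
Proof. by move=> l; rewrite mxE; case: (D l <= t)%N => //; apply: pihomogP. Qed.

Lemma hcomp_id t u : hv D t u -> hcomp D t u = u.
Proof.
move=> hu; apply/rowP => l; rewrite mxE; move: (hu l).
by case: (D l <= t)%N => [/pihomog_dE|/eqP].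
Qed.

Lemma hvP t u : hv D t u <-> hcomp D t u = u.
Proof. by split=> [/hcomp_id|<-]; last exact: hv_hcomp. Qed.

Lemma hcompD t u v : hcomp D t (u + v) = hcomp D t u + hcomp D t v.
Proof.
by apply/rowP => l; rewrite !mxE; case: (D l <= t)%N; rewrite ?addr0 // raddfD.
Qed.

Lemma hcomp0 t : hcomp D t 0 = 0.
Proof. by apply/rowP => l; rewrite !mxE raddf0 if_same. Qed.

Lemma hcompN t u : hcomp D t (- u) = - hcomp D t u.
Proof.
by apply/rowP => l; rewrite !mxE; case: (D l <= t)%N; rewrite ?oppr0 // raddfN.
Qed.

Lemma hv0 t : hv D t 0. Proof. by apply/hvP/hcomp0. Qed.

Lemma hvD t u v : hv D t u -> hv D t v -> hv D t (u + v).
Proof. by move=> /hvP hu /hvP hw; apply/hvP; rewrite hcompD hu hw. Qed.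

Lemma hvN t u : hv D t u -> hv D t (- u).
Proof. by move=> /hvP hu; apply/hvP; rewrite hcompN hu. Qed.

Lemma hvB t u v : hv D t u -> hv D t v -> hv D t (u - v).
Proof. by move=> hu hw; apply: hvD => //; apply: hvN. Qed.

Lemma hv_scale s t (p : P) u : p \is s.-homog -> hv D t u -> hv D (t + s) (p *: u).
Proof.
move=> hp hu l; rewrite !mxE; move: (hu l); case: ifP => [lt_|_ /eqP ->]; last first.
  by rewrite mulr0; case: ifP => // _; apply: dhomog0.
rewrite (leq_trans lt_ (leq_addr _ _)) => hul.
by rewrite -addnBAC // addnC; apply: dhomogM.
Qed.

Lemma hv_mulX t i u : hv D t u -> hv D t.+1 ('X_i *: u).
Proof. by move=> hu; rewrite -addn1; apply: hv_scale => //; apply: X_dhomog. Qed.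

Lemma hv_scalec t c u : hv D t u -> hv D t (c%:MP *: u).
Proof.
move=> hu; rewrite -[t]addn0; apply: hv_scale => //.
by rewrite -[c%:MP]mulr1 mul_mpolyC dhomogZ ?dhomog1.
Qed.

Lemma hcomp_mulX t i u : hcomp D t.+1 ('X_i *: u) = 'X_i *: hcomp D t u.
Proof.
apply/rowP => l; rewrite !mxE; case: (ltngtP (D l) t.+1) => [lt_|gt_|eq_].
- by rewrite -ltnS lt_ subSn // pihomogX_mul.
- by rewrite leqNgt (ltnW gt_) mulr0.
- rewrite {1}eq_ subnn leqNgt eq_ ltnSn mulr0 mulrC.
  by rewrite (pihomogM0 _ (X_dhomog k i)).
Qed.

Lemma hcomp_mulX0 i u : hcomp D 0 ('X_i *: u) = 0.
Proof.
apply/rowP => l; rewrite !mxE; case: ifP => // _.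
by rewrite mulrC sub0n (pihomogM0 _ (X_dhomog k i)).
Qed.

Lemma hcomp_sum u : exists K, u = \sum_(t < K) hcomp D t u.
Proof.
exists (\max_l (D l + mmeasure mdeg (u 0%R l)))%N; set K := (\max_l _)%N.
apply/rowP => l; rewrite summxE.
under eq_bigr do rewrite mxE.
have lK : (D l + mmeasure mdeg (u 0%R l) <= K)%N.
  exact: (leq_bigmax_cond (F := fun l => (D l + mmeasure mdeg (u 0%R l))%N)).
pose F t := if (D l <= t)%N then pihomog mdeg (t - D l) (u 0 l) else 0.
rewrite -(big_mkord xpredT F) (big_cat_nat (n := D l)) //=; last by lia.
rewrite big_nat big1 => [|t /andP[_ tD]]; last by rewrite /F leqNgt tD.
rewrite add0r -{1}[D l]add0n big_addn big_mkord.
have uK : (mmeasure mdeg (u 0%R l) <= K - D l)%N by lia.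
rewrite {1}(pihomog_partitionE uK); apply: eq_bigr => t _.
by rewrite /F leq_addl addnK.
Qed.

Lemma vec_nonconst_split u : (forall l, (u 0 l)@_0%MM = 0) ->
  exists a b, u = 'X_0 *: a + 'X_1 *: b.
Proof.
move=> u0.
have /fin_all_exists[f uE] l : exists ab : P * P, u 0 l = 'X_0 * ab.1 + 'X_1 * ab.2.
  by have [a [b ->]] := nonconst_split (u0 l); exists (a, b).
exists (\row_l (f l).1), (\row_l (f l).2); apply/rowP => l.
by rewrite !mxE uE.
Qed.

Lemma vec_syzygy u v : 'X_0 *: u = 'X_1 *: v ->
  exists q, u = 'X_1 *: q /\ v = 'X_0 *: q.
Proof.
move=> uv.
have /fin_all_exists[f uE] l : exists q : P, u 0 l = 'X_1 * q /\ v 0 l = 'X_0 * q.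
  by apply: X_syzygy; move/rowP/(_ l): uv; rewrite !mxE.
by exists (\row_l f l); split; apply/rowP => l; rewrite !mxE; case: (uE l).
Qed.

(** In degree 0 all entries are constants, hence vanish; this case stops the inductions on the
    degree. *)
Lemma hv_split t u : hv D t u -> (forall l, (u 0 l)@_0%MM = 0) ->
  if t is t'.+1 then
    exists a b, [/\ hv D t' a, hv D t' b & u = 'X_0 *: a + 'X_1 *: b]
  else u = 0.
Proof.
move=> hu /vec_nonconst_split[a [b uE]].
move: hu => /hvP; rewrite uE hcompD.
case: t => [|t]; first by rewrite !hcomp_mulX0 addr0 => <-.
rewrite !hcomp_mulX => <-.
by exists (hcomp D t a), (hcomp D t b); split=> //; apply: hv_hcomp.
Qed.

Lemma hv_syzygy t u v : hv D t u -> hv D t v -> 'X_0 *: u = 'X_1 *: v ->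
  if t is t'.+1 then exists q, [/\ hv D t' q, u = 'X_1 *: q & v = 'X_0 *: q]
  else u = 0 /\ v = 0.
Proof.
move=> /hvP hu /hvP hw /vec_syzygy[q [uE vE]].
move: hu hw; rewrite uE vE; case: t => [|t]; first by rewrite !hcomp_mulX0.
rewrite !hcomp_mulX => <- <-.
by exists (hcomp D t q); split=> //; apply: hv_hcomp.
Qed.

End OneModule.

Definition rows_hv m n (S : 'I_m -> nat) (D : 'I_n -> nat) (M : 'M[P]_(m, n)) :=
  forall i, hv D (S i) (row i M).

(** This is what makes exactness on all vectors equivalent to exactness in each degree. *)
Lemma hcomp_mul m n (S : 'I_m -> nat) (D : 'I_n -> nat) (M : 'M[P]_(m, n)) t w :
  rows_hv S D M -> hcomp D t (w *m M) = hcomp S t w *m M.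
Proof.
move=> hM; apply/rowP => l; rewrite !mxE.
under [RHS]eq_bigr do rewrite mxE.
have -> : (if (D l <= t)%N then pihomog mdeg (t - D l) (\sum_i w 0 i * M i l) else 0) =
  \sum_i if (D l <= t)%N then pihomog mdeg (t - D l) (w 0 i * M i l) else 0.
  by case: ifP => _; [rewrite raddf_sum | rewrite big1].
apply: eq_bigr => i _; move: (hM i l); rewrite mxE.
case: leqP => [DS hMil|_ /eqP ->]; last by rewrite !mulr0 raddf0 if_same.
case: (leqP (S i) t) => [St|tS].
  rewrite (leq_trans DS St) -(pihomogM _ _ hMil); congr (pihomog _ _ _).
  by rewrite addnC addnBAC // subnKC.
rewrite mul0r; case: ifP => // Dt; rewrite (pihomogM0 _ hMil) //.
by rewrite ltn_sub2r // (leq_ltn_trans Dt).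
Qed.

Lemma hv_mul m n (S : 'I_m -> nat) (D : 'I_n -> nat) (M : 'M[P]_(m, n)) t w :
  rows_hv S D M -> hv S t w -> hv D t (w *m M).
Proof. by move=> hM /hvP hw; apply/hvP; rewrite (hcomp_mul _ _ hM) hw. Qed.

Lemma hv_delta m (S : 'I_m -> nat) i : hv S (S i) (delta_mx 0 i).
Proof.
move=> l; rewrite mxE eqxx /=; case: (eqVneq l i) => [->|_].
  by rewrite leqnn subnn dhomog1.
by case: ifP => // _; apply: dhomog0.
Qed.

(* By homogeneity, a relation with a nonzero constant coefficient expresses one
   row through the others. *)
Definition irredundant m n (S : 'I_m -> nat) (M : 'M[P]_(m, n)) :=
  forall t w, hv S t w -> w *m M = 0 -> forall i, (w 0 i)@_0%MM = 0.

(** A relation of degree s splits into coefficients of degree s - 1, so the vector q has degree s -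
    2: saturation is asked only for t + 2 ≤ s. Thanks to this bound, saturation below degree j
    excludes relations up to degree j + 1. *)
Lemma irredundant_free m n (S : 'I_m -> nat) (D : 'I_n -> nat) (M : 'M[P]_(m, n)) s :
  rows_hv S D M -> irredundant S M ->
  (forall t q, (t.+1 < s)%N -> hv D t q ->
     (forall i : 'I_2, exists2 a, hv S t.+1 a & 'X_i *: q = a *m M) ->
     exists2 c, hv S t c & q = c *m M) ->
  forall w, hv S s w -> w *m M = 0 -> w = 0.
Proof.
move=> hM irrM; elim: s => [|s IH] sat w hw wM.
  exact: hv_split hw (irrM _ _ hw wM).
have {}IH := IH (fun t q ts => sat t q (leqW ts)).
have [a [b [ha hb wE]]] := hv_split hw (irrM _ _ hw wM).
have ab : 'X_0 *: (a *m M) = 'X_1 *: (- b *m M).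
  apply/eqP; rewrite mulNmx scalerN -addr_eq0 -wM wE mulmxDl.
  by rewrite -!scalemxAl.
have haM := hv_mul hM ha; have hbM := hv_mul hM (hvN hb).
have := hv_syzygy haM hbM ab; case: s => [|s] in hw ha hb haM hbM sat IH *.
  (* Here w has degree 1, so both products have degree 0 and, being multiples of a variable,
     vanish. *)
  case=> aM /eqP; rewrite mulNmx oppr_eq0 => /eqP bM.
  by rewrite wE (IH _ ha aM) (IH _ hb bM) !scaler0 addr0.
case=> q [hq aq bq].
have [c hc qE] : exists2 c, hv S s c & q = c *m M.
  apply: (sat s q) => // i; case: (ord2P i) => ->.
    by exists (- b); first exact: hvN.
  by exists a.
have a0 : a - 'X_1 *: c = 0.
  apply: IH; first by apply: hvB => //; apply: hv_mulX.
  by rewrite mulmxBl aq -scalemxAl -qE subrr.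
have b0 : b + 'X_0 *: c = 0.
  apply: IH; first by apply: hvD => //; apply: hv_mulX.
  rewrite mulmxDl -scalemxAl -qE -bq mulNmx; exact: addrN.
move/eqP: a0; rewrite subr_eq0 wE => /eqP ->; move/eqP: b0; rewrite addr_eq0 => /eqP ->.
by rewrite scalerN !scalerA mulrC addrN.
Qed.

(** Nakayama in a single degree: the unit vector at i minus x a + y b would be a relation with
    constant coefficient 1 at i. *)
Lemma irredundant_indecomposable m n (S : 'I_m -> nat) (M : 'M[P]_(m, n)) t i a b :
  irredundant S M -> S i = t.+1 -> hv S t a -> hv S t b ->
  row i M = ('X_0 *: a + 'X_1 *: b) *m M -> False.
Proof.
move=> irrM Si ha hb /eqP; rewrite rowE -subr_eq0 -mulmxBl => /eqP rel.
have hw : hv S t.+1 (delta_mx 0 i - ('X_0 *: a + 'X_1 *: b)).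
  by apply: hvB; [rewrite -Si; apply: hv_delta | apply: hvD; apply: hv_mulX].
have := irrM _ _ hw rel i; rewrite !mxE !eqxx !mcoeffB mcoeff1 eqxx.
rewrite mcoeffD !mcoeff_mulX0 ?mnm0E // addr0 subr0 => /eqP.
by rewrite oner_eq0.
Qed.

Definition spans m n (S : 'I_m -> nat) (M : 'M[P]_(m, n)) (N : nat -> 'rV[P]_n -> Prop) :=
  forall t u, N t u <-> exists2 w, hv S t w & u = w *m M.

Lemma spans_irredundant m n (D : 'I_n -> nat) (S : 'I_m -> nat) (M : 'M[P]_(m, n)) N :
  rows_hv S D M -> spans S M N ->
  exists m' (S' : 'I_m' -> nat) (M' : 'M[P]_(m', n)),
    [/\ rows_hv S' D M', spans S' M' N & irredundant S' M'].
Proof.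
elim: m => [|m IH] in S M *.
  by move=> hM sM; exists 0%N, S, M; split=> // t w _ _ [].
move=> hM sM; have [irrM|] := classic (irredundant S M); first by exists m.+1, S, M.
move=> nirr.
have [t [w [i [hw wM wi]]]] : exists t w i, [/\ hv S t w, w *m M = 0 & (w 0 i)@_0%MM <> 0].
  apply: NNPP => H; apply: nirr => t w hw wM i; apply: NNPP => wi.
  by apply: H; exists t, w, i.
(* A homogeneous entry with a nonzero constant coefficient has degree t - S_i = 0, so it is a
   unit. *)
have [Sit wiE] : S i = t /\ w 0 i = ((w 0 i)@_0%MM)%:MP.
  move: (hw i); case: leqP => [St|_ /eqP wi0]; last by rewrite wi0 mcoeff0 in wi.
  case E: (t - S i)%N => [|s] hwi; last by rewrite (dhomogS_const hwi) in wi.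
  by split; [lia | exact: dhomog0E].
apply: (IH (fun l => S (lift i l)) (row' i M)) => [l|].
  by have := hM (lift i l); congr hv; apply/rowP => j; rewrite !mxE.
have mulE (z : 'rV_m.+1) : z 0 i = 0 -> z *m M = col' i z *m row' i M.
  move=> z0; apply/rowP => j; rewrite !mxE (bigD1_ord i) //= z0 mul0r add0r.
  by apply: eq_bigr => l _; rewrite !mxE.
move=> s u; rewrite sM; split=> [[v hvv ->]|[v hvv ->]]; last first.
  pose z : 'rV[P]_m.+1 := \row_l if unlift i l is Some l' then v 0 l' else 0.
  exists z.
    move=> l; rewrite mxE; case: unliftP => [l' ->|_]; first exact: hvv.
    by case: ifP => // _; apply: dhomog0.
  rewrite mulE; last by rewrite mxE unlift_none.
  by congr (_ *m _); apply/rowP => l; rewrite !mxE liftK.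
have wi0 : (w 0 i)@_0%MM != 0 by apply/eqP.
(* Subtracting a multiple of the relation w clears coordinate i and does not change the product with
   M. *)
pose z := v - (((w 0 i)@_0%MM)^-1%:MP * v 0 i) *: w.
have z0 : z 0 i = 0.
  by rewrite !mxE {2}wiE mulrAC -mpolyCM mulVf // mpolyC1 mul1r subrr.
exists (col' i z).
  move=> l; rewrite mxE.
  suff hz : hv S s z by apply: hz.
  apply: hvB => //; move: (hvv i); case: leqP => [St|_ /eqP ->]; last first.
    by rewrite mulr0 scale0r; apply: hv0.
  move=> hvi; rewrite -scalerA; apply: hv_scalec.
  by rewrite -(subnKC St) {1}Sit; apply: hv_scale.
by rewrite -(mulE z z0) mulmxBl -scalemxAl wM scaler0 subr0.
Qed.

End HomogeneousVectors.

(** * Graded submodules of free modules *)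

Section Vspaces.
Variable k : fieldType.

Lemma linfunE (aT rT : vectType k) (f : aT -> rT) : linear f -> linfun f =1 f.
Proof.
move=> lin_f x.
have Lin := GRing.isLinear.Build _ _ _ _ _ lin_f.
pose F : {linear aT -> rT} := HB.pack f Lin.
exact: (lfunE F).
Qed.

(** A subspace inside Q grows by one vector at a time, excluded middle deciding whether Q has a
    vector outside; m bounds the remaining codimension. Graded pieces given by predicates thus
    acquire bases. *)
Lemma subspace_vspace (vT : vectType k) (Q : vT -> Prop) :
  Q 0 -> (forall a u v, Q u -> Q v -> Q (a *: u + v)) ->
  exists U : {vspace vT}, forall v, Q v <-> v \in U.
Proof.
move=> Q0 QD.
have ext m (U : {vspace vT}) : (forall v, v \in U -> Q v) -> (dim vT <= \dim U + m)%N ->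
    exists W : {vspace vT}, forall v, Q v <-> v \in W.
  elim: m U => [|m IH] U QU.
    rewrite addn0 -dimvf => full; exists U => v; split=> [_|/QU //].
    suff /eqP -> : U == fullv by apply: memvf.
    by rewrite eqEdim subvf.
  have [QsubU _|nQ] := classic (forall v, Q v -> v \in U).
    by exists U => v; split; [apply: QsubU | apply: QU].
  have [v Qv vU] : exists2 v, Q v & v \notin U.
    apply: NNPP => H; apply: nQ => v Qv; apply: contraT => vU; case: H; by exists v.
  move=> le; apply: (IH (<[v]> + U)%VS).
    move=> w /memv_addP[_ /vlineP[a ->] [u uU ->]]; exact: QD (QU _ uU).
  rewrite (leq_trans le) // addnS -addSn leq_add2r.
  have sub : (U <= <[v]> + U)%VS by exact: addvSr.
  rewrite (ltn_leqif (dimv_leqif_sup sub)); apply: contra vU => /subvP; apply.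
  exact: (subvP (addvSl _ _) _ (memv_line v)).
apply: (ext (dim vT) 0%VS) => [v|]; last by rewrite dimv0.
by rewrite memv0 => /eqP ->.
Qed.

End Vspaces.

(** * Coordinates on a graded piece of a free module *)

Section Coordinates.
Variable k : fieldType.
Local Notation P := (poly2 k).

Definition mon d a : 'X_{1..2} := [multinom (if i == 0%R then a else (d - a)%N) | i < 2].

Lemma mdeg_mon d a : (a <= d)%N -> mdeg (mon d a) = d.
Proof.
by move=> ad; rewrite mdegE !big_ord_recl big_ord0 !mnmE /=; lia.
Qed.

Lemma monE d (m : 'X_{1..2}) : mdeg m = d -> m = mon d (m 0).
Proof.
rewrite mdegE !big_ord_recl big_ord0 addn0 => <-; apply: mnm2P; rewrite !mnmE //=.
rewrite [lift _ _](_ : _ = 1) ?addKn //; exact: val_inj.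
Qed.

Lemma mon_inj d : injective (mon d).
Proof. by move=> a b /(congr1 (fun m : 'X_{1..2} => m 0)); rewrite !mnmE. Qed.

Section Model.
Variables (n : nat) (D : 'I_n -> nat) (t : nat).

(* Coefficients of the homogeneous vectors of degree [t] in [\oplus_l R(-D_l)]:
   the coefficient at [(l, a)] is that of [x^a y^(t - D_l - a)] in entry [l]. *)
Definition coords := {ffun {l : 'I_n & 'I_(t.+1 - D l)} -> k^o}.

Definition cindex l (a : 'I_(t.+1 - D l)) : {l : 'I_n & 'I_(t.+1 - D l)} :=
  Tagged (fun l => 'I_(t.+1 - D l)) a.

Definition of_coords (c : coords) : 'rV[P]_n :=
  \row_l \sum_(a < t.+1 - D l) c (cindex a) *: 'X_[mon (t - D l) a].

Definition to_coords (u : 'rV[P]_n) : coords :=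
  [ffun x : {l : 'I_n & 'I_(t.+1 - D l)} =>
     (u 0 (tag x))@_(mon (t - D (tag x)) (tagged x)) : k^o].

(** The term [t.+1 - D l] is the dimension of degree t of R(-D_l) also when t < D_l, where
    truncation gives 0. *)
Lemma dim_coords : \dim {: coords} = (\sum_l (t.+1 - D l))%N.
Proof.
rewrite dimvf [LHS](_ : _ = #|{: {l : 'I_n & 'I_(t.+1 - D l)}}| * 1)%N // muln1.
by rewrite card_tagged sumnE big_map big_enum; apply: eq_bigr => l _; rewrite card_ord.
Qed.

Lemma hv_of_coords c : hv D t (of_coords c).
Proof.
move=> l; rewrite mxE; case: leqP => [Dt|tD].
  rewrite rpred_sum // => a _; apply: dhomogZ; rewrite dhomogX; apply/eqP.
  by apply: mdeg_mon; have := ltn_ord a; lia.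
by rewrite big1 // => a _; have := ltn_ord a; lia.
Qed.

Lemma of_coords_linear a u v :
  of_coords (a *: u + v) = a%:MP *: of_coords u + of_coords v.
Proof.
apply/rowP => l; rewrite !mxE mul_mpolyC scaler_sumr -big_split.
by apply: eq_bigr => i _; rewrite !ffunE scalerDl scalerA.
Qed.

Lemma to_coords_linear a u v :
  to_coords (a%:MP *: u + v) = a *: to_coords u + to_coords v.
Proof. by apply/ffunP => x; rewrite !ffunE !mxE mcoeffD mcoeffCM. Qed.

Lemma of_coordsK : cancel of_coords to_coords.
Proof.
move=> c; apply/ffunP => -[l a]; rewrite ffunE mxE raddf_sum /= (bigD1 a) //=.
rewrite mcoeffZ mcoeffX eqxx mulr1 big1 ?addr0 // => b ba.
rewrite mcoeffZ mcoeffX; case: eqP => [/mon_inj/val_inj ba'|]; last by rewrite mulr0.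
by rewrite ba' eqxx in ba.
Qed.

Lemma to_coordsK u : hv D t u -> of_coords (to_coords u) = u.
Proof.
move=> hu; apply/rowP => l; rewrite mxE; move: (hu l); case: leqP => [Dt hul|tD /eqP ->].
  apply/mpolyP => m; rewrite raddf_sum /=.
  under eq_bigr do rewrite mcoeffZ mcoeffX ffunE /=.
  have [md|md] := eqVneq (mdeg m) (t - D l)%N; last first.
    rewrite (dhomog_nemf_coeff hul md) big1 // => a _.
    case: eqP => [am|]; last by rewrite mulr0.
    by rewrite -am mdeg_mon ?eqxx // in md; have := ltn_ord a; lia.
  have lt0 : (m 0%R < t.+1 - D l)%N.
    by move: md; rewrite mdegE (bigD1 (0 : 'I_2)) //=; lia.
  rewrite (bigD1 (Ordinal lt0)) //= -(monE md) eqxx mulr1 big1 ?addr0 // => a am.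
  case: eqP => [ma|]; last by rewrite mulr0.
  case/eqP: am; apply: val_inj; apply: (@mon_inj (t - D l)).
  by rewrite ma /= -(monE md).
by rewrite big1 // => a _; have := ltn_ord a; lia.
Qed.

End Model.

End Coordinates.

Section GradedSubmodules.
Variable k : fieldType.
Local Notation P := (poly2 k).

(** Stated for predicates on row vectors so as to cover ideals (n = 1) and syzygy modules alike. *)
Record graded_sub n (D : 'I_n -> nat) (N : nat -> 'rV[P]_n -> Prop) : Prop := GradedSub {
  gs_hv : forall t u, N t u -> hv D t u;
  gs_0 : forall t, N t 0;
  gs_D : forall t u v, N t u -> N t v -> N t (u + v);
  gs_Z : forall t c u, N t u -> N t (c%:MP *: u);
  gs_X : forall t i u, N t u -> N t.+1 ('X_i *: u) }.

Section Submodule.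
Variables (n : nat) (D : 'I_n -> nat) (N : nat -> 'rV[P]_n -> Prop).
Hypothesis subN : graded_sub D N.

Lemma gs_mul t s h u : N t u -> h \is s.-homog -> N (t + s) (h *: u).
Proof.
elim: s t h u => [|s IH] t h u Nu hh.
  by rewrite addn0 (dhomog0E hh); apply: (gs_Z subN).
have [a [b [ha hb ->]]] := dhomog_split hh.
rewrite scalerDl -!scalerA addnS; apply: (gs_D subN); apply: (gs_X subN); exact: IH.
Qed.

Lemma gs_mulmx m (S : 'I_m -> nat) (M : 'M[P]_(m, n)) t w :
  (forall i, N (S i) (row i M)) -> hv S t w -> N t (w *m M).
Proof.
move=> NM hw; rewrite mulmx_sum_row; elim/big_rec: _ => [|i u _ Nu]; first exact: (gs_0 subN).
apply: (gs_D subN) => //; move: (hw i); case: leqP => [St hi|_ /eqP ->].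
  by rewrite -(subnKC St); apply: gs_mul.
by rewrite scale0r; apply: (gs_0 subN).
Qed.

Lemma gs_fin_basis t : exists r (B : 'M[P]_(r, n)),
  (forall i, N t (row i B)) /\
  forall u, N t u -> exists2 w, hv (fun _ : 'I_r => t) t w & u = w *m B.
Proof.
have [U UE] : exists U : {vspace coords k D t}, forall c, N t (of_coords c) <-> c \in U.
  apply: (subspace_vspace (Q := fun c => N t (of_coords c))).
    suff -> : of_coords (0 : coords k D t) = 0 by apply: (gs_0 subN).
    by apply/rowP => l; rewrite !mxE big1 // => a _; rewrite ffunE scale0r.
  move=> a u v Nu Nv; rewrite of_coords_linear.
  by apply: (gs_D subN) => //; apply: (gs_Z subN).
pose B : 'M[P]_(\dim U, n) := \matrix_i of_coords (vbasis U)`_i.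
exists (\dim U), B; split=> [i|u Nu].
  by rewrite rowK; apply/UE/vbasis_mem/mem_nth; rewrite size_tuple.
have hu := gs_hv subN Nu.
have uU : to_coords D t u \in U by apply/UE; rewrite to_coordsK.
exists (\row_i (coord (vbasis U) i (to_coords D t u))%:MP).
  move=> i; rewrite leqnn subnn mxE -[_%:MP]mulr1 mul_mpolyC.
  by apply: dhomogZ; apply: dhomog1.
rewrite -{1}(to_coordsK hu) {1}(coord_vbasis uU).
have sumE I (r : seq I) (F : I -> coords k D t) c :
    of_coords (\sum_(i <- r) c i *: F i) = \sum_(i <- r) (c i)%:MP *: of_coords (F i).
  elim: r => [|i r IH]; last by rewrite !big_cons of_coords_linear IH.
  rewrite !big_nil; apply/rowP => l; rewrite !mxE big1 // => a _.
  by rewrite ffunE scale0r.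
by rewrite sumE mulmx_sum_row; apply: eq_bigr => i _; rewrite mxE rowK.
Qed.

Lemma gs_fin_gen_upto T : exists m (S : 'I_m -> nat) (M : 'M[P]_(m, n)),
  (forall i, N (S i) (row i M)) /\
  forall t u, (t < T)%N -> N t u -> exists2 w, hv S t w & u = w *m M.
Proof.
elim: T => [|T [m [S [M [NM sM]]]]].
  by exists 0%N, (fun=> 0%N), 0; split=> // -[].
have [r [B [NB sB]]] := gs_fin_basis T.
pose S' (i : 'I_(m + r)) := match split i with inl a => S a | inr _ => T end.
have S'l a : S' (lshift r a) = S a.
  by rewrite /S' -[lshift r a]/(unsplit (inl a)) unsplitK.
have S'r a : S' (rshift m a) = T.
  by rewrite /S' -[rshift m a]/(unsplit (inr a)) unsplitK.
exists (m + r)%N, S', (col_mx M B); split=> [i|t u].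
  case: (split_ordP i) => a ->; rewrite ?S'l ?S'r ?rowKu ?rowKd //.
rewrite ltnS leq_eqVlt => /predU1P[->|tT] Nu.
  have [w hw ->] := sB _ Nu; exists (row_mx 0 w).
    move=> i; case: (split_ordP i) => a ->.
      by rewrite row_mxEl mxE; case: ifP => // _; apply: dhomog0.
    by rewrite row_mxEr S'r; apply: hw.
  by rewrite mul_row_col mul0mx add0r.
have [w hw ->] := sM _ _ tT Nu; exists (row_mx w 0).
  move=> i; case: (split_ordP i) => a ->.
    by rewrite row_mxEl S'l; apply: hw.
  by rewrite row_mxEr mxE; case: ifP => // _; apply: dhomog0.
by rewrite mul_row_col mul0mx addr0.
Qed.

(** Bases of the pieces up to degree T generate, since each later piece is R_1 times the previous
    one. After pruning, no generator can lie above T, by [irredundant_indecomposable]. *)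
Lemma gs_min_gen T :
  (forall t u, (T <= t)%N -> N t.+1 u ->
     exists a b, [/\ N t a, N t b & u = 'X_0 *: a + 'X_1 *: b]) ->
  exists m (S : 'I_m -> nat) (M : 'M[P]_(m, n)),
    [/\ rows_hv S D M, spans S M N, irredundant S M & forall i, (S i <= T)%N].
Proof.
move=> dec; have [m [S [M [NM sM]]]] := gs_fin_gen_upto T.+1.
have hM : rows_hv S D M by move=> i; apply: (gs_hv subN).
have spM : spans S M N.
  move=> t u; split=> [|[w hw ->]]; last exact: gs_mulmx.
  elim: t u => [|t IH] u Nu; first exact: sM.
  have [tT|Tt] := ltnP t T; first exact: sM.
  have [a [b [Na Nb ->]]] := dec _ _ Tt Nu.
  have [wa ha ->] := IH _ Na; have [wb hb ->] := IH _ Nb.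
  exists ('X_0 *: wa + 'X_1 *: wb); last by rewrite mulmxDl -!scalemxAl.
  by apply: hvD; apply: hv_mulX.
have [m' [S' [M' [hM' sM' irrM']]]] := spans_irredundant hM spM.
exists m', S', M'; split=> // i; rewrite leqNgt; apply/negP => TS.
case E : (S' i) TS => [|t] // Tt.
have Nrow : N t.+1 (row i M').
  by rewrite -E rowE; apply/sM'; exists (delta_mx 0 i) => //; apply: hv_delta.
have [a [b [/sM'[wa ha aE] /sM'[wb hb bE] rowE]]] := dec _ _ Tt Nrow.
apply: (irredundant_indecomposable irrM' E ha hb).
by rewrite rowE aE bE mulmxDl -!scalemxAl.
Qed.

End Submodule.
End GradedSubmodules.

(** * Minimal resolutions *)

Section SortedGenerators.
Variable k : fieldType.
Local Notation P := (poly2 k).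

(** The resolutions list their degrees in a prescribed order; once sorted, equal multisets of
    degrees become equal lists. *)
Lemma spans_sorted m n (D : 'I_n -> nat) (S : 'I_m -> nat) (M : 'M[P]_(m, n)) N
    (r : rel nat) : total r ->
  rows_hv S D M -> spans S M N -> irredundant S M ->
  exists (S' : 'I_m -> nat) (M' : 'M[P]_(m, n)),
    [/\ rows_hv S' D M', spans S' M' N, irredundant S' M', sorted r (codom S') &
        forall T, (forall i, (S i <= T)%N) -> forall i, (S' i <= T)%N].
Proof.
move=> tot_r hM sM irrM.
have : perm_eq (sort r (codom S)) [tuple S i | i < m] by rewrite perm_sort.
case/tuple_permP=> s sE.
have codE : codom (S \o s) = sort r (codom S).
  by rewrite sE codomE; apply: eq_map => i /=; rewrite tnth_mktuple.
have mulE (w : 'rV[P]_m) : w *m M = col_perm s w *m row_perm s M.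
  by rewrite mul_col_perm -row_permM mulVg row_perm1.
have mulE' (w : 'rV[P]_m) : w *m row_perm s M = col_perm s^-1 w *m M.
  by rewrite mul_col_perm invgK.
have hE t (w : 'rV[P]_m) : hv S t w -> hv (S \o s) t (col_perm s w).
  by move=> hw i; rewrite mxE; apply: hw.
have hE' t (w : 'rV[P]_m) : hv (S \o s) t w -> hv S t (col_perm s^-1 w).
  by move=> hw i; have := hw (s^-1 i)%g; rewrite !mxE /= permKV.
exists (S \o s), (row_perm s M); split=> [i|t u|t w hw||].
- by have := hM (s i); congr hv; apply/rowP => j; rewrite !mxE.
- rewrite sM; split=> [[w hw ->]|[w hw ->]].
    by exists (col_perm s w); [exact: hE | exact: mulE].
  by exists (col_perm s^-1 w); [exact: hE' | exact: mulE'].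
- rewrite mulE' => /(irrM _ _ (hE' _ _ hw)) w0 i.
  by have := w0 (s i); rewrite mxE permK.
- by rewrite codE sort_sorted.
- by move=> T ST i; apply: ST.
Qed.

End SortedGenerators.

Section Resolutions.
Variable k : fieldType.
Local Notation P := (poly2 k).
Implicit Types J : gideal k.

Local Notation zdeg := (fun _ : 'I_1 => 0%N).

(* A minimal resolution in the sense of [graded_res] and [minimal_mx], with
   exactness stated degree by degree; see [minres_graded_res]. *)
Record minres J m n (D : 'I_n -> nat) (S : 'I_m -> nat)
    (g : 'M[P]_(n, 1)) (phi : 'M[P]_(m, n)) : Prop := MinRes {
  mr_gen_hv : rows_hv D zdeg g;
  mr_rel_hv : rows_hv S D phi;
  mr_gen : forall t p, pmem (J t) p <-> exists2 u, hv D t u & u *m g = p%:M;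
  mr_rel : forall t u, hv D t u -> u *m g = 0 -> exists2 w, hv S t w & u = w *m phi;
  mr_comp : phi *m g = 0;
  mr_inj : forall t w, hv S t w -> w *m phi = 0 -> w = 0;
  mr_min : minimal_mx phi }.

Lemma hcomp_scalar t (p : P) : hcomp zdeg t p%:M = (pihomog mdeg t p)%:M.
Proof. by apply/rowP => i; rewrite !mxE !ord1 subn0 /= !mulr1n. Qed.

Lemma hv_scalar t (p : P) : hv zdeg t p%:M <-> p \is t.-homog.
Proof.
by split=> [/(_ 0)|hp i]; rewrite mxE subn0 ?ord1 mulr1n.
Qed.

Lemma zhomog_subz (a b : nat) (p : P) :
  zhomog (a%:Z - b%:Z) p = if (b <= a)%N then p \is (a - b).-homog else p == 0.
Proof.
case: leqP => ba; first by rewrite subzn.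
by have -> : a%:Z - b%:Z = Negz (b - a).-1 by lia.
Qed.

Section MinRes.
Variables (J : gideal k) (m n : nat) (D : 'I_n -> nat) (S : 'I_m -> nat).
Variables (g : 'M[P]_(n, 1)) (phi : 'M[P]_(m, n)).

Section Theory.
Hypothesis R : minres J D S g phi.

(** A homogeneous relation is some w phi, and the entries of phi have no constant coefficients. *)
Lemma mr_irredundant : irredundant D g.
Proof.
move=> t u hu /(mr_rel R hu)[w _ ->] l.
rewrite mxE raddf_sum big1 //= => i _.
by rewrite rmorphM /= (mr_min R) mulr0.
Qed.

Lemma mr_gen_bound T :
  (forall t p, (T <= t)%N -> pmem (J t.+1) p -> pmem (R1mul (J t)) p) ->
  forall l, (D l <= T)%N.
Proof.
move=> dec l; rewrite leqNgt; apply/negP.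
case E : (D l) => [|t] // Tt.
have gl : row l g = (g l 0)%:M by apply/rowP => i; rewrite !ord1 !mxE mulr1n.
have : pmem (J t.+1) (g l 0).
  apply/(mr_gen R); exists (delta_mx 0 l); last by rewrite -rowE gl.
  by rewrite -E; apply: hv_delta.
move=> /(dec _ _ Tt)/pmem_R1mul[a [b [/(mr_gen R)[u hu ua] /(mr_gen R)[v hv_ vb] glE]]].
apply: (irredundant_indecomposable mr_irredundant E hu hv_).
rewrite gl glE mulmxDl -!scalemxAl ua vb; apply/rowP => i.
by rewrite !ord1 !mxE !mulr1n.
Qed.

Lemma mr_gen_nz l : g l 0 != 0.
Proof.
apply/eqP => gl; have := mr_irredundant (@hv_delta k n D l).
rewrite -rowE => /(_ _ l); rewrite mxE !eqxx mcoeff1 eqxx => H.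
suff /H/eqP : row l g = 0 by rewrite oner_eq0.
by apply/rowP => i; rewrite !ord1 !mxE gl.
Qed.

Lemma mr_gen_mem l : pmem (J (D l)) (g l 0).
Proof.
apply/(mr_gen R); exists (delta_mx 0 l); first exact: hv_delta.
by rewrite -rowE; apply/rowP => i; rewrite !ord1 !mxE mulr1n.
Qed.

Lemma mr_rel_nz i : row i phi != 0.
Proof.
rewrite rowE; apply/eqP => /(mr_inj R (@hv_delta k m S i)).
by move/rowP/(_ i); rewrite !mxE !eqxx => /eqP; rewrite oner_eq0.
Qed.

(** A nonzero entry of row i has degree S_i - D_l; degree 0 would make it a nonzero constant,
    against minimality. *)
Lemma mr_rel_gt i : exists l, (D l < S i)%N.
Proof.
have /rV0Pn[l] := mr_rel_nz i; rewrite mxE => nz; exists l.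
have := mr_rel_hv R i l; rewrite mxE.
case: (leqP (D l) (S i)) => [|_ /eqP e]; last by rewrite e eqxx in nz.
rewrite leq_eqVlt => /predU1P[->|//]; rewrite subnn => /dhomog0E e.
by rewrite e (mr_min R) mpolyC0 eqxx in nz.
Qed.

(** Row i of phi is a relation of degree S_i. If S_i ≤ j + 1, then [irredundant_free] needs
    saturation only in degrees t < j and kills the row, which is nonzero by injectivity of phi. *)
Lemma mr_rel_bound j :
  (forall t p, (t < j)%N -> p \is t.-homog ->
     (forall i : 'I_2, pmem (J t.+1) ('X_i * p)) -> pmem (J t) p) ->
  forall i, (j.+1 < S i)%N.
Proof.
move=> sat i; rewrite ltnNge; apply/negP => Sj.
have := mr_rel_nz i; apply/negP; rewrite negbK; apply/eqP.
apply: (irredundant_free (mr_gen_hv R) mr_irredundant _ (mr_rel_hv R i)); last first.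
  by rewrite -row_mul (mr_comp R) row0.
move=> t q tS hq Xq.
have qE : q = (q 0 0)%:M by apply/rowP => l; rewrite !ord1 !mxE mulr1n.
have /(mr_gen R)[c hc cE] : pmem (J t) (q 0 0).
  apply: sat; [lia | by apply/hv_scalar; rewrite -qE|] => l.
  apply/(mr_gen R); have [a ha aE] := Xq l; exists a => //.
  by rewrite -aE {1}qE; apply/rowP => l'; rewrite !ord1 !mxE !mulr1n.
by exists c; rewrite // qE.
Qed.

(** Rank-nullity, in coordinates, for the map onto J_t: its kernel is the image of the relations,
    which embed. *)
Lemma mr_dim t :
  (\sum_l (t.+1 - D l) = \dim (J t) + \sum_i (t.+1 - S i))%N.
Proof.
pose f (w : coords k S t) : coords k D t := to_coords D t (of_coords w *m phi).
pose h (u : coords k D t) : Rform k t := indhomog t ((of_coords u *m g) 0 0).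
have h_homog (u : coords k D t) : (of_coords u *m g) 0 0 \is t.-homog.
  apply/hv_scalar; rewrite -mx11_scalar.
  exact: hv_mul (mr_gen_hv R) (hv_of_coords u).
have lin_f : linear f.
  move=> a u v; rewrite /f of_coords_linear mulmxDl -scalemxAl; exact: to_coords_linear.
have lin_h : linear h.
  move=> a u v; apply: val_inj => /=; rewrite [LHS]indhomogK //.
  rewrite of_coords_linear mulmxDl -scalemxAl !mxE mul_mpolyC.
  by congr (_ *: _ + _); rewrite -[RHS]/(mpoly_of_dhomog _) indhomogK // mxE.
have f_mul w : of_coords (f w) = of_coords w *m phi.
  by apply: to_coordsK; apply: hv_mul (mr_rel_hv R) (hv_of_coords w).
rewrite -(dim_coords k D) -(dim_coords k S) -(limg_ker_dim (linfun h) fullv).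
rewrite capfv addnC; congr (_ + _)%N.
  congr (\dim _); apply: pmem_eq => p; apply/pmemP/idP.
    case=> _ /memv_imgP[u _ ->] ->; apply/(mr_gen R); rewrite (linfunE lin_h) indhomogK //.
    by exists (of_coords u); [exact: hv_of_coords | exact: mx11_scalar].
  case/(mr_gen R)=> u hu up; have pE : p = h (to_coords D t u).
    by rewrite indhomogK // to_coordsK // up mxE mulr1n.
  by exists (h (to_coords D t u)); rewrite // -(linfunE lin_h) memv_img ?memvf.
have f_inj : lker (linfun f) == 0%VS.
  apply/lker0P => u v; rewrite !(linfunE lin_f) => fE.
  rewrite -[u]of_coordsK -[v]of_coordsK; congr to_coords; apply/eqP.
  rewrite -subr_eq0; apply/eqP.
  apply: (mr_inj R (hvB (hv_of_coords u) (hv_of_coords v))).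
  by rewrite mulmxBl -!f_mul fE subrr.
rewrite -(limg_dim_eq (f := linfun f) (U := fullv)); last by rewrite (eqP f_inj) capv0.
congr (\dim _); apply/vspaceP => u; rewrite memv_ker (linfunE lin_h).
apply/eqP/memv_imgP => [hu0|[w _ ->]].
  have ug : of_coords u *m g = 0.
    rewrite [LHS]mx11_scalar -(indhomogK (h_homog u)) -[indhomog _ _]/(h u) hu0.
    by apply/rowP => i; rewrite !mxE mul0rn.
  have [w hw uE] := mr_rel R (hv_of_coords u) ug.
  exists (to_coords S t w); first exact: memvf.
  by rewrite (linfunE lin_f) /f to_coordsK // -uE of_coordsK.
apply: val_inj => /=; rewrite (linfunE lin_f) [LHS]indhomogK // f_mul -mulmxA.
by rewrite (mr_comp R) mulmx0 mxE.
Qed.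

End Theory.
End MinRes.
End Resolutions.

(** * Exactness on all vectors and exactness in each degree *)

Section Conversions.
Variable k : fieldType.
Local Notation P := (poly2 k).
Local Notation zdeg := (fun _ : 'I_1 => 0%N).

Lemma in_gideal_homog (J : gideal k) t (p : P) : p \is t.-homog ->
  in_gideal J p <-> pmem (J t) p.
Proof.
move=> hp; split=> [/(_ t)|pJ s]; first by rewrite /pmem hp pihomog_dE.
have [<-|ts] := eqVneq t s; first by rewrite pihomog_dE //; case/andP: pJ.
rewrite (pihomog_ne0 ts hp).
by have := pmem0 (J s); rewrite /pmem => /andP[].
Qed.

Lemma in_gidealP (J : gideal k) (p : P) :
  in_gideal J p <-> forall t, pmem (J t) (pihomog mdeg t p).
Proof.
split=> [pJ t|pJ t]; first by rewrite /pmem pihomogP pJ.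
by case/andP: (pJ t).
Qed.

(** The ideal and its quotient differ in one condition, that g be minimal too: a generator with a
    nonzero constant coefficient has degree 0 and puts 1 into J. *)
Lemma minres_graded_res (J : gideal k) (m n : nat) (D : 'I_n -> nat) (S : 'I_m -> nat)
    (g : 'M[P]_(n, 1)) (phi : 'M[P]_(m, n)) (G Sq : seq int) :
  minres J D S g phi ->
  G = [seq (D l)%:Z | l <- enum 'I_n] -> Sq = [seq (S i)%:Z | i <- enum 'I_m] ->
  min_res_ideal J G Sq /\ (~~ pmem (J 0) 1 -> min_res_quot J G Sq).
Proof.
move=> R GE SqE.
have Gn : size G = n by rewrite GE size_map size_enum_ord.
have Sm : size Sq = m by rewrite SqE size_map size_enum_ord.
have GD (l : 'I_n) : G`_l = (D l)%:Z.
  by rewrite GE (nth_map l) ?nth_ord_enum // size_enum_ord.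
have SqS (i : 'I_m) : Sq`_i = (S i)%:Z.
  by rewrite SqE (nth_map i) ?nth_ord_enum // size_enum_ord.
clear GE SqE; move: D S g phi R GD SqS; case: n / Gn; case: m / Sm => D S g phi R GD SqS.
have res : @graded_res k J G Sq g phi.
  split=> [l|i l|p|u|w].
  - rewrite GD /=; have := mr_gen_hv R l 0.
    by rewrite mxE subn0.
  - rewrite GD SqS zhomog_subz; have := mr_rel_hv R i l.
    by rewrite mxE.
  - rewrite in_gidealP; split=> [pJ|[u ug] t]; last first.
      apply/(mr_gen R); exists (hcomp D t u); first exact: hv_hcomp.
      by rewrite -(hcomp_mul _ _ (mr_gen_hv R)) ug hcomp_scalar.
    have [K pE] : exists K, p = \sum_(t < K) pihomog mdeg t p.
      by exists (mmeasure mdeg p); apply: pihomog_partitionE.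
    have /fin_all_exists[u uE] (t : 'I_K) : exists u : 'rV[P]__, u *m g = (pihomog mdeg t p)%:M.
      by have [u _ uE] := (proj1 (mr_gen R _ _) (pJ t)); exists u.
    exists (\sum_t u t); rewrite mulmx_suml {1}pE raddf_sum.
    by apply: eq_bigr => t _; apply: uE.
  - split=> [ug|[w ->]]; last by rewrite -mulmxA (mr_comp R) mulmx0.
    have [K uE] := hcomp_sum D u.
    have /fin_all_exists[w wE] (t : 'I_K) : exists w : 'rV[P]__, hcomp D t u = w *m phi.
      have ut : hcomp D t u *m g = 0 by rewrite -(hcomp_mul _ _ (mr_gen_hv R)) ug hcomp0.
      by have [w _ wE] := mr_rel R (hv_hcomp D t u) ut; exists w.
    by exists (\sum_t w t); rewrite {1}uE mulmx_suml; apply: eq_bigr => t _; apply: wE.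
  - move=> wphi; have [K ->] := hcomp_sum S w; rewrite big1 // => t _.
    apply: (mr_inj R (hv_hcomp S t w)).
    by rewrite -(hcomp_mul _ _ (mr_rel_hv R)) wphi hcomp0.
split; first by exists g, phi; split=> //; apply: mr_min R.
move=> J0; exists g, phi; split=> //; first exact: mr_min R.
move=> l i; rewrite ord1; have := mr_gen_mem R l.
case E : (D l) => [|t] gJ; last exact: dhomogS_const (pmem_homog gJ).
apply/eqP; apply: contraNT J0 => c0.
have -> : 1 = ((g l 0)@_0%MM)^-1 *: g l 0.
  by rewrite {2}(dhomog0E (pmem_homog gJ)) -mul_mpolyC -mpolyCM mulVf.
exact: pmemZ.
Qed.

Lemma graded_res_minres (J : gideal k) (G Sq : seq int) g phi :
  @graded_res k J G Sq g phi -> minimal_mx phi ->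
  (forall i : 'I_(size Sq), 0 <= Sq`_i) ->
  (forall l : 'I_(size G), 0 <= G`_l) /\
  minres J (fun l : 'I_(size G) => absz (G`_l)) (fun i : 'I_(size Sq) => absz (Sq`_i)) g phi.
Proof.
move=> R minphi Sq0.
have G0 (l : 'I_(size G)) : 0 <= G`_l.
  (* A generator of negative degree would be 0; its unit vector would then be a relation with
     constant coefficient 1, which phi cannot produce. *)
  have := res_gen_deg R l; case: (G`_l) => // e /= /eqP gl.
  have eg : delta_mx 0 l *m g = 0 :> 'rV_1.
    by rewrite -rowE; apply/rowP => i; rewrite !mxE ord1.
  have [w /rowP/(_ l)] := proj1 (res_rel R _) eg.
  move/(congr1 (mcoeff 0%MM)); rewrite !mxE !eqxx mcoeff1 eqxx raddf_sum big1 /=.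
    by move/eqP; rewrite oner_eq0.
  by move=> i _; rewrite rmorphM /= minphi mulr0.
split=> //.
pose D (l : 'I_(size G)) := absz (G`_l); pose S (i : 'I_(size Sq)) := absz (Sq`_i).
have GD (l : 'I_(size G)) : G`_l = (D l)%:Z by rewrite /D gez0_abs.
have SqS (i : 'I_(size Sq)) : Sq`_i = (S i)%:Z by rewrite /S gez0_abs.
have g_hv : rows_hv D zdeg g.
  move=> l i; rewrite ord1 mxE subn0 /=; have := res_gen_deg R l.
  by rewrite GD.
have phi_hv : rows_hv S D phi.
  by move=> i l; have := res_rel_deg R i l; rewrite GD SqS zhomog_subz mxE.
split=> // [t p|t u hu ug||t w hw wphi].
- split=> [pJ|[u hu up]].
    have hp := pmem_homog pJ.
    have [u up] := proj1 (res_gen R p) (proj2 (in_gideal_homog _ hp) pJ).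
    exists (hcomp D t u); first exact: hv_hcomp.
    by rewrite -(hcomp_mul _ _ g_hv) up hcomp_scalar pihomog_dE.
  have hp : p \is t.-homog by apply/hv_scalar; rewrite -up; apply: hv_mul hu.
  by apply/(in_gideal_homog _ hp)/(res_gen R); exists u.
- have [w uw] := proj1 (res_rel R u) ug; exists (hcomp S t w); first exact: hv_hcomp.
  by rewrite -(hcomp_mul _ _ phi_hv) -uw hcomp_id.
- apply/row_matrixP => i; rewrite row0 row_mul; apply/(res_rel R).
  by exists (delta_mx 0 i); rewrite -rowE.
- exact: (res_inj R).
Qed.

End Conversions.

(** * Existence of minimal resolutions *)

Section Existence.
Variable k : fieldType.
Local Notation P := (poly2 k).
Local Notation zdeg := (fun _ : 'I_1 => 0%N).

Definition graded_ideal (J : gideal k) :=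
  forall t i p, pmem (J t) p -> pmem (J t.+1) ('X_i * p).

Lemma mx11E (u : 'rV[P]_1) : u = (u 0 0)%:M.
Proof. by apply/rowP => i; rewrite !ord1 !mxE mulr1n. Qed.

Lemma graded_sub_ideal (J : gideal k) : graded_ideal J ->
  graded_sub zdeg (fun t (u : 'rV[P]_1) => pmem (J t) (u 0 0)).
Proof.
move=> idJ; split=> [t u uJ|t|t u v uJ vJ|t c u uJ|t i u uJ].
- by rewrite [u]mx11E; apply/hv_scalar/(pmem_homog uJ).
- by rewrite mxE pmem0.
- by rewrite mxE pmemD.
- by rewrite mxE mul_mpolyC pmemZ.
- by rewrite mxE idJ.
Qed.

Lemma graded_sub_syz m n (S : 'I_m -> nat) (M : 'M[P]_(m, n)) :
  graded_sub S (fun t (u : 'rV[P]_m) => hv S t u /\ u *m M = 0).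
Proof.
split=> [t u []//|t|t u v [hu uM] [hw vM]|t c u [hu uM]|t i u [hu uM]].
- by split; [apply: hv0 | rewrite mul0mx].
- by split; [apply: hvD | rewrite mulmxDl uM vM addr0].
- by split; [apply: hv_scalec | rewrite -scalemxAl uM scaler0].
- by split; [apply: hv_mulX | rewrite -scalemxAl uM scaler0].
Qed.

(* Above degree [T] every form belongs to [J], so for a relation [x a + y b] of
   degree [> T.+1] the form [q] with [a g = y q], [b g = - x q] is some [c g], and
   the relation is [x (a - y c) + y (b + x c)]. *)
Theorem minres_exists (J : gideal k) T :
  graded_ideal J -> (forall t, (T <= t)%N -> J t = fullv) ->
  exists m n (D : 'I_n -> nat) (S : 'I_m -> nat) (g : 'M[P]_(n, 1)) (phi : 'M[P]_(m, n)),
    [/\ minres J D S g phi, sorted leq (codom D), sorted geq (codom S),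
        forall l, (D l <= T)%N & forall i, (S i <= T.+1)%N].
Proof.
move=> idJ fullJ.
have decJ t (u : 'rV[P]_1) : (T <= t)%N -> pmem (J t.+1) (u 0 0) ->
    exists a b : 'rV[P]_1, [/\ pmem (J t) (a 0 0), pmem (J t) (b 0 0) & u = 'X_0 *: a + 'X_1 *: b].
  move=> Tt /pmem_homog/dhomog_split[a [b [ha hb uE]]].
  exists a%:M, b%:M; rewrite !mxE !mulr1n fullJ // !pmem_full; split=> //.
  by rewrite [u]mx11E uE raddfD /= !scale_scalar_mx.
have [n [D0 [g0 [hg0 sg0 irrg0 DT0]]]] := gs_min_gen (graded_sub_ideal idJ) decJ.
have [D [g [hg sg irrg sortD /(_ _ DT0) DT]]] := spans_sorted leq_total hg0 sg0 irrg0.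
have decZ t u : (T.+1 <= t)%N -> hv D t.+1 u /\ u *m g = 0 ->
    exists a b : 'rV[P]_n, [/\ hv D t a /\ a *m g = 0, hv D t b /\ b *m g = 0 &
      u = 'X_0 *: a + 'X_1 *: b].
  case: t => // t; rewrite ltnS => Tt [hu ug].
  have [a [b [ha hb uE]]] := hv_split hu (irrg _ _ hu ug).
  have ab : 'X_0 *: (a *m g) = 'X_1 *: (- b *m g).
    apply/eqP; rewrite mulNmx scalerN -addr_eq0 -ug uE mulmxDl.
    by rewrite -!scalemxAl.
  have [q [hq aq bq]] := hv_syzygy (hv_mul hg ha) (hv_mul hg (hvN hb)) ab.
  have /sg[c hc cE] : pmem (J t) (q 0 0).
    by rewrite fullJ // pmem_full; apply/hv_scalar; rewrite -mx11E.
  exists (a - 'X_1 *: c), (b + 'X_0 *: c); split; [split|split|].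
  - by apply: hvB => //; apply: hv_mulX.
  - by rewrite mulmxBl aq -scalemxAl -cE subrr.
  - by apply: hvD => //; apply: hv_mulX.
  - by rewrite mulmxDl -scalemxAl -cE -bq mulNmx addrN.
  - by rewrite uE scalerBr scalerDr !scalerA mulrC addrACA addNr addr0.
have [m [S0 [phi0 [hphi0 sphi0 irrphi0 ST0]]]] := gs_min_gen (graded_sub_syz D g) decZ.
have tot_geq : total geq by move=> a b; apply: leq_total.
have [S [phi [hphi sphi irrphi sortS /(_ _ ST0) ST]]] := spans_sorted tot_geq hphi0 sphi0 irrphi0.
have phiZ i : row i phi *m g = 0.
  have [] // := proj2 (sphi (S i) (row i phi)).
  by rewrite rowE; exists (delta_mx 0 i) => //; apply: hv_delta.
exists m, n, D, S, g, phi; split=> //; split=> //.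
- move=> t p; rewrite [p in pmem _ p](_ : p = (p%:M : 'M_1) 0 0); last by rewrite mxE mulr1n.
  by split=> [/sg[u hu uE]|[u hu uE]]; [exists u | apply/sg; exists u].
- by move=> t u hu ug; apply/sphi.
- by apply/row_matrixP => i; rewrite row0 row_mul phiZ.
(* Syzygies are saturated in every degree: if x q is one, then x (q g) = 0 forces q g = 0. *)
- move=> t w hw wphi; apply: (irredundant_free hphi irrphi _ hw wphi) => s q _ hq Xq.
  apply/sphi; split=> //; have [a ha aE] := Xq 0.
  have : ('X_0 *: q) *m g = 0.
    by have [] := proj2 (sphi _ _) (ex_intro2 _ _ a ha aE).
  rewrite -scalemxAl => /rowP q0; apply/rowP => i; have := q0 i; rewrite !mxE => /eqP.
  by rewrite mulf_eq0 (negPf (X_neq0 k 0)) => /eqP.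
- by move=> i l; have := irrg _ _ (hphi i) (phiZ i) l; rewrite mxE.
Qed.

End Existence.

(** * Partitions and the resolutions attached to V *)

Section Partitions.
Local Open Scope nat_scope.
Implicit Types A B X Y s : seq nat.

Lemma sum_subSl s t : \sum_(x <- s) (t.+1 - x) = \sum_(x <- s) (t - x) + count (fun x => x <= t) s.
Proof.
elim: s => [|x s IH]; rewrite ?big_nil // !big_cons /= IH.
by case: leqP => /= xt; lia.
Qed.

Lemma sum_subSr s i : \sum_(x <- s) (x - i) = \sum_(x <- s) (x - i.+1) + count (fun x => i < x) s.
Proof.
elim: s => [|x s IH]; rewrite ?big_nil // !big_cons /= IH.
by case: ltnP => /= xt; lia.
Qed.

Lemma count_le_eq s t : count (fun x => x <= t) s = count (fun x => x < t) s + count_mem t s.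
Proof.
elim: s => //= x s ->; by case: ltngtP => /=; lia.
Qed.

(** The first difference in t of these sums counts the elements at most t; the second difference is
    the multiplicity of t. *)
Lemma perm_eq_sums K X Y : all (fun x => x <= K) X -> all (fun x => x <= K) Y ->
  (forall t, t <= K -> \sum_(x <- X) (t.+1 - x) = \sum_(y <- Y) (t.+1 - y)) ->
  perm_eq X Y.
Proof.
move=> XK YK XY.
have le t : t <= K -> count (fun x => x <= t) X = count (fun x => x <= t) Y.
  move=> tK; have := XY t tK; rewrite !sum_subSl.
  case: t tK => [|t] tK; last by rewrite XY ?(ltnW tK) // => /addnI.
  by rewrite !big1 // => *; rewrite sub0n.
apply/allP => t _ /=; apply/eqP; case: (leqP t K) => [tK|Kt].
  have := le t tK; rewrite !count_le_eq.
  case: t tK => [|t] tK; last by rewrite !le ?(ltnW tK) // => /addnI.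
  by rewrite !(@eq_count _ (fun x => x < 0) pred0) // !count_pred0.
have nt Z : all (fun x => x <= K) Z -> count_mem t Z = 0.
  move=> ZK; apply/count_memPn/negP => /(allP ZK); lia.
by rewrite !nt.
Qed.

(** Termwise, both sides are max(i, x). This exchanges what relations subtract from dim I for what
    they add to H. *)
Lemma sum_sub_swap s i :
  \sum_(x <- s) (i - x) + sumn s = size s * i + \sum_(x <- s) (x - i).
Proof. by elim: s => [|x s IH]; rewrite ?big_nil // !big_cons /=; lia. Qed.

Lemma sum_sub_large s i : sumn s <= i -> \sum_(x <- s) (x - i) = 0.
Proof. elim: s => [|x s IH]; rewrite ?big_nil // !big_cons /= => si; rewrite IH; lia. Qed.

Lemma mem_sumn_le s x : x \in s -> x <= sumn s.
Proof. by elim: s => //= y s IH; rewrite inE => /predU1P[->|/IH]; lia. Qed.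

Lemma sum_addl s i : \sum_(x <- s) (i + x) = size s * i + sumn s.
Proof. by elim: s => [|x s IH]; rewrite ?big_nil // !big_cons /=; lia. Qed.

Lemma sumnE0 s : sumn s = \sum_(x <- s) (x - 0).
Proof. by rewrite sumnE; apply: eq_bigr => x _; rewrite subn0. Qed.

Lemma sorted_cat_nseq (r : rel nat) s n c : transitive r -> reflexive r ->
  sorted r s -> all (fun x => r x c) s -> sorted r (s ++ nseq n c).
Proof.
move=> tr rr; rewrite !sorted_pairwise // pairwise_cat => -> sc; rewrite andTb.
apply/andP; split; first by apply/allrelP => x y xs /nseqP[-> _]; exact: (allP sc).
elim: n => //= n ->; rewrite andbT; apply/allP => y /nseqP[-> _]; exact: rr.
Qed.

Lemma part_dualp s i : 0 < i -> part (dualp s) i = count (fun a => i <= a) s.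
Proof.
case: i => // i _; rewrite /part /dualp /=; set M := \max_(a <- s) a.
have [iM|Mi] := ltnP i M; first by rewrite (nth_map 0) ?size_iota // nth_iota.
rewrite nth_default ?size_map ?size_iota //; apply/esym/eqP; rewrite -leqn0 leqNgt -has_count.
apply/hasPn => a sa; rewrite -leqNgt; apply: leq_trans Mi.
exact: (leq_bigmax_seq (F := id)).
Qed.

Lemma sumn_dualp s : sumn (dualp s) = sumn s.
Proof.
rewrite /dualp; set M := \max_(a <- s) a.
have leM : all (fun a => a <= M) s.
  by apply/allP => a sa; exact: (leq_bigmax_seq (F := id)).
(* Boxes of the Young diagram: the list counts the first m columns, the sum of the x - m what sticks
   out. *)
have H m : sumn s =
    \sum_(x <- s) (x - m) + sumn [seq count (fun a => i <= a) s | i <- iota 1 m].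
  elim: m => [|m IH]; first by rewrite sumnE0 addn0.
  have -> : iota 1 m.+1 = iota 1 m ++ [:: m.+1] by rewrite -[in LHS](addn1 m) iotaD add1n.
  rewrite IH sum_subSr map_cat sumn_cat /=; lia.
rewrite (H M) big_seq big1 ?add0n // => x /(allP leM) /=.
by rewrite -subn_eq0 => /eqP.
Qed.

End Partitions.

(** * Resolutions for the ancestor ideal, the level ideal and (V) *)

Section AncestorResolution.
Variables (k : fieldType) (j : nat) (V : {vspace Rform k j}).

Lemma graded_ideal_ancestor : graded_ideal (ancestor V).
Proof. by move=> t i p; rewrite !ancestorE; apply: RV_mulX. Qed.

Lemma ancestor_decomp t p : (j <= t)%N ->
  pmem (ancestor V t.+1) p -> pmem (R1mul (ancestor V t)) p.
Proof. by move=> jt; rewrite !ancestorE RV_up. Qed.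

Lemma ancestor_saturated t p : (t < j)%N -> p \is t.-homog ->
  (forall i : 'I_2, pmem (ancestor V t.+1) ('X_i * p)) -> pmem (ancestor V t) p.
Proof.
by move=> tj hp Xp; rewrite ancestorE RV_down // pmem_R1colon hp -!ancestorE !Xp.
Qed.

Lemma sum_nth_int (s : seq int) (F : nat -> nat) :
  (\sum_(l < size s) F (absz (nth 0%R s l)) = \sum_(x <- s) F (absz x))%N.
Proof. by rewrite (big_nth 0%R) big_mkord. Qed.

(** All that the numerical part takes from a resolution. In degree t, [t + a - j] and [t - (j + b)]
    are the dimensions of R(-(j + 1 - a)) and R(-(j + 1 + b)); a ≤ j + 1 says that generator degrees
    are not negative. *)
Record ancestor_partitions (A B : seq nat) : Prop := AncestorPartitions {
  ap_A : all (fun a => (1 <= a <= j.+1)%N) A;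
  ap_B : all (leq 1) B;
  ap_dim : forall t,
    (\sum_(a <- A) (t + a - j) = \dim (RV V t) + \sum_(b <- B) (t - (j + b)))%N }.

Lemma minres_ancestor_partitions (A B : seq nat) :
  min_res_ideal (ancestor V) (gen_degs j A) (rel_degs j B) -> ancestor_partitions A B.
Proof.
case=> g [phi [res minphi]].
have S0 (i : 'I_(size (rel_degs j B))) : 0 <= (rel_degs j B)`_i.
  have := mem_nth 0 (ltn_ord i); case/mapP=> b _ ->; lia.
have [G0 R] := graded_res_minres res minphi S0.
have Dj := mr_gen_bound R ancestor_decomp.
have Sj := mr_rel_bound R ancestor_saturated.
have HA : all (fun a => (1 <= a <= j.+1)%N) A.
  apply/allP => a aA; have lt : (index a A < size (gen_degs j A))%N by rewrite size_map index_mem.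
  have := G0 (Ordinal lt); have := Dj (Ordinal lt).
  rewrite /gen_degs /= (nth_map 0%N) ?index_mem // nth_index //; lia.
have HB : all (leq 1) B.
  apply/allP => b bB; have lt : (index b B < size (rel_degs j B))%N by rewrite size_map index_mem.
  have := Sj (Ordinal lt).
  rewrite /rel_degs /= (nth_map 0%N) ?index_mem // nth_index //; lia.
split=> // t; have := mr_dim R t; rewrite ancestorE.
rewrite (sum_nth_int (gen_degs j A) (fun x => (t.+1 - x)%N)).
rewrite (sum_nth_int (rel_degs j B) (fun x => (t.+1 - x)%N)) !big_map => dimE.
have -> : (\sum_(a <- A) (t + a - j) = \sum_(a <- A) (t.+1 - absz (j.+1%:Z - a%:Z)%R))%N.
  by rewrite big_seq [RHS]big_seq; apply: eq_bigr => a /(allP HA); lia.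
by rewrite dimE; congr (_ + _)%N; apply: eq_bigr => b _; lia.
Qed.

Variable T : nat.
Hypothesis fullV : forall t, (T <= t)%N -> \dim (RV V t) = t.+1.

Lemma ancestor_full t : (T <= t)%N -> ancestor V t = fullv.
Proof.
by move=> Tt; apply/eqP; rewrite ancestorE eqEdim subvf dim_Rform (fullV Tt) leqnn.
Qed.

Lemma ancestor_minres_exists : exists A B, [/\ sorted geq A, sorted geq B &
  min_res_ideal (ancestor V) (gen_degs j A) (rel_degs j B)].
Proof.
have [m [n [D [S [g [phi [R sD sS _ _]]]]]]] := minres_exists graded_ideal_ancestor ancestor_full.
have Dj := mr_gen_bound R ancestor_decomp.
have Sj := mr_rel_bound R ancestor_saturated.
(* No truncation occurs, by [Dj] and [Sj]. Generators are listed by increasing degree and relations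
   by decreasing degree, so both partitions are non-increasing. *)
exists [seq (j.+1 - x)%N | x <- codom D], [seq (x - j.+1)%N | x <- codom S]; split.
- by apply: (homo_sorted _ _ sD) => x y xy; apply: leq_sub2l.
- by apply: (homo_sorted _ _ sS) => x y xy; apply: leq_sub2r.
- apply: (proj1 (minres_graded_res R _ _)); rewrite /gen_degs /rel_degs codomE -!map_comp.
    by apply: eq_map => l /=; have := Dj l; lia.
  by apply: eq_map => l /=; have := Sj l; lia.
Qed.

Section Numerics.
Variables A B : seq nat.
Hypothesis ap : ancestor_partitions A B.

Lemma ap_dim_lower i : (i <= j)%N -> \dim (RV V (j - i)) = (\sum_(a <- A) (a - i))%N.
Proof.
move=> ij; have := ap_dim ap (j - i)%N.
rewrite [X in (_ = _ + X)%N]big1 ?addn0 => [<-|b _]; last lia.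
by apply: eq_bigr => a _; lia.
Qed.

Lemma ap_sumA : sumn A = \dim V.
Proof. by rewrite sumnE0 -ap_dim_lower // subn0 RV_id. Qed.

Lemma ap_dim_upper i :
  (size A * i + sumn A = \dim (RV V (j + i)) + \sum_(b <- B) (i - b))%N.
Proof.
rewrite -sum_addl; have := ap_dim ap (j + i)%N.
rewrite (eq_bigr (fun a => i + a)%N) => [->|a _]; last lia.
by congr (_ + _)%N; apply: eq_bigr => b _; lia.
Qed.

(** In large degrees the ideal is everything, so [ap_dim_upper] becomes an identity between linear
    functions of i: slopes give the numbers of parts, constant terms the sums. *)
Lemma ap_sizes : size A = (size B).+1 /\ (sumn A + sumn B = j.+1)%N.
Proof.
(* From K on, the pieces are full and no [i - b] is truncated. *)
pose K := maxn T (sumn B).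
have KE i : (K <= i)%N -> (size A * i + sumn A + sumn B = (j + i).+1 + size B * i)%N.
  move=> Ki; have := ap_dim_upper i; rewrite fullV; last by rewrite /K in Ki; lia.
  have := sum_sub_swap B i; rewrite sum_sub_large; first lia.
  by rewrite /K in Ki; lia.
have e1 := KE K (leqnn K); have e2 := KE K.+1 (leqnSn K).
rewrite !mulnS in e2; have sz : size A = (size B).+1 by lia.
by split=> //; rewrite sz mulSn in e1; lia.
Qed.

Lemma ap_hilb_upper i : (\dim (RV V (j + i)) + \sum_(b <- B) (b - i) = (j + i).+1)%N.
Proof.
have [sz sm] := ap_sizes; have := ap_dim_upper i; have := sum_sub_swap B i.
rewrite sz mulSn; lia.
Qed.

(** Relations start in degree j + 2, so in degree j + 1 nothing is subtracted and every generator
    adds one more dimension than in degree j. *)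
Lemma ap_dimS : \dim (RV V j.+1) = (\dim V + size A)%N.
Proof.
have := ap_dim_upper 1; rewrite addn1 ap_sumA muln1 big_seq big1 => [|b /(allP (ap_B ap))]; lia.
Qed.

Lemma ap_size_le : (size A <= \dim V)%N.
Proof.
rewrite -ap_sumA; elim: A (ap_A ap) => //= a s IH /andP[a1 /IH]; lia.
Qed.

Lemma sum_codom n (D : 'I_n -> nat) (F : nat -> nat) :
  (\sum_(l < n) F (D l) = \sum_(x <- codom D) F x)%N.
Proof. by rewrite codomE big_map big_enum. Qed.

Lemma minres_quot_codom (J : gideal k) m n (D : 'I_n -> nat) (S : 'I_m -> nat) g phi X Y :
  minres J D S g phi -> ~~ pmem (J 0) 1 -> codom D = X -> codom S = Y ->
  min_res_quot J (map Posz X) (map Posz Y).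
Proof.
move=> R J0 <- <-; apply: (proj2 (minres_graded_res R _ _)) => //; by rewrite codomE -map_comp.
Qed.

Hypothesis V_neq_full : (\dim V <= j)%N.

(** If 1 lay in R_{-j} V, all of R_j would lie in V. *)
Lemma ancestor_proper : ~~ pmem (ancestor V 0) 1.
Proof.
rewrite ancestorE; apply/negP => /(pmem_RV_lower _ _ (leq0n j))[_ full].
suff /eqP Vf : V == fullv by move: V_neq_full; rewrite Vf dim_Rform ltnn.
rewrite eqEsubv subvf; apply/pmem_sub => p; rewrite pmem_full => hp.
by rewrite -[p]mulr1 full // subn0.
Qed.

Lemma ancestor_quot_res :
  min_res_ideal (ancestor V) (gen_degs j A) (rel_degs j B) ->
  min_res_quot (ancestor V) (gen_degs j A) (rel_degs j B).
Proof.
case=> g [phi [res minphi]].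
have S0 (i : 'I_(size (rel_degs j B))) : 0 <= (rel_degs j B)`_i.
  have := mem_nth 0 (ltn_ord i); case/mapP=> b _ ->; lia.
have [G0 R] := graded_res_minres res minphi S0.
have seqE (s : seq int) : (forall i : 'I_(size s), 0 <= s`_i) ->
    s = [seq (absz s`_(val l))%:Z | l <- enum 'I_(size s)].
  move=> s0; apply: (@eq_from_nth _ 0); first by rewrite size_map size_enum_ord.
  move=> i lt; rewrite (nth_map (Ordinal lt)) ?size_enum_ord //.
  by rewrite /= nth_enum_ord // gez0_abs // (s0 (Ordinal lt)).
apply: (proj2 (minres_graded_res R _ _)); [exact: seqE | exact: seqE | exact: ancestor_proper].
Qed.

Lemma level_idealE t : level_ideal V t = if (t <= j)%N then RV V t else fullv.
Proof.
rewrite /level_ideal /maxpow ancestorE; case: leqP => tj; first by rewrite addv0.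
by apply/eqP; rewrite eqEsubv subvf addvSr.
Qed.

Lemma graded_ideal_level : graded_ideal (level_ideal V).
Proof.
move=> t i p; rewrite !level_idealE; case: (ltnP t j) => tj.
  by rewrite (ltnW tj); apply: RV_mulX.
rewrite pmem_full => /pmem_homog; exact: dhomogXM.
Qed.

(** No relation has degree at most j + 1, so the dimensions up to there give the generators. The new
    ones fill the gap between R_1 V, of dimension d + tau, and R_{j+1}, of dimension j + 2. *)
Lemma level_quot_res : sorted geq A -> min_res_quot (level_ideal V)
  (gen_degs j A ++ nseq (j.+2 - \dim V - size A) j.+1%:Z) (nseq (j.+1 - \dim V) j.+2%:Z).
Proof.
move=> sorted_A; have fullL t : (j.+1 <= t)%N -> level_ideal V t = fullv.
  by move=> jt; rewrite level_idealE leqNgt jt.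
have [m [n [D [S [g [phi [R sD sS DT ST]]]]]]] := minres_exists graded_ideal_level fullL.
have satL t p : (t < j)%N -> p \is t.-homog ->
    (forall i : 'I_2, pmem (level_ideal V t.+1) ('X_i * p)) -> pmem (level_ideal V t) p.
  move=> tj hp; rewrite !level_idealE tj (ltnW tj) -!ancestorE; exact: ancestor_saturated.
have Sj := mr_rel_bound R satL.
pose X := [seq (j.+1 - a)%N | a <- A] ++ nseq (j.+2 - \dim V - size A) j.+1.
have dimS := ap_dimS; have sA := ap_sumA.
have dimS_le : (\dim V + size A <= j.+2)%N.
  by rewrite -dimS; apply: dim_Rform_le.
have sumX t : (\sum_(x <- X) (t.+1 - x) =
    \sum_(a <- A) (t + a - j) + (j.+2 - \dim V - size A) * (t - j))%N.
  rewrite /X big_cat big_map big_nseq iter_addn_0 /= subSS mulnC; congr (_ + _)%N.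
  rewrite big_seq [RHS]big_seq; apply: eq_bigr => a /(allP (ap_A ap)); lia.
have sumXj i : (\sum_(x <- X) ((j + i).+1 - x) =
    size A * i + \dim V + (j.+2 - \dim V - size A) * i)%N.
  rewrite sumX addKn -sA -sum_addl; congr (_ + _)%N.
  by apply: eq_bigr => a _; lia.
have sorted_X : sorted leq X.
  apply: sorted_cat_nseq => //; first exact: leq_trans.
    by apply: (homo_sorted _ _ sorted_A) => x y xy; apply: leq_sub2l.
  by apply/allP => _ /mapP[a _ ->]; apply: leq_subr.
have DX : codom D = X.
  apply: (sorted_eq leq_trans anti_leq sD sorted_X); apply: (@perm_eq_sums j.+1).
  - by apply/allP => _ /codomP[l ->].
  - rewrite /X all_cat; apply/andP; split; last by apply/allP => _ /nseqP[-> _] /=.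
    by apply/allP => _ /mapP[a _ ->]; apply: leq_subr.
  move=> t tj; rewrite -(sum_codom D (fun x => (t.+1 - x)%N)) (mr_dim R) addnC.
  rewrite big1 => [|i _]; last by have := Sj i; lia.
  rewrite add0n level_idealE; case: leqP => [tj'|jt].
    rewrite sumX; have := ap_dim ap t; rewrite [X in (_ + X)%N]big1 => [->|b _]; lia.
  have -> : t = (j + 1)%N by lia.
  by rewrite dim_Rform sumXj; lia.
(* Saturation below j gives S_i > j + 1 and fullness from j + 1 on gives S_i ≤ j + 2; the dimension
   in degree j + 2 then counts the relations. *)
have SE : codom S = nseq (j.+1 - \dim V) j.+2.
  have /all_pred1P -> : all (pred1 j.+2) (codom S).
    by apply/allP => _ /codomP[i ->]; have := Sj i; have := ST i; rewrite /=; lia.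
  rewrite size_codom card_ord; congr nseq; have := mr_dim R j.+2.
  rewrite (sum_codom D (fun x => (j.+3 - x)%N)) DX -[j.+3]/(j.+2.+1) -(addn2 j) sumXj.
  rewrite fullL ?dim_Rform; last lia.
  rewrite (eq_bigr (fun=> 1%N)) => [|i _]; last by have := Sj i; have := ST i; lia.
  rewrite sum1_card card_ord; lia.
have -> : gen_degs j A ++ nseq (j.+2 - \dim V - size A) j.+1%:Z = map Posz X.
  rewrite map_cat map_nseq -map_comp; congr (_ ++ _).
  by apply/eq_in_map => a /(allP (ap_A ap)) /=; lia.
have -> : nseq (j.+1 - \dim V) j.+2%:Z = map Posz (nseq (j.+1 - \dim V) j.+2) by rewrite map_nseq.
apply: (minres_quot_codom R) => //.
by rewrite level_idealE /= -ancestorE ancestor_proper.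
Qed.

(** In degrees at least j the pieces are those of the ancestor ideal, so their dimensions are known
    from A and B; with d generators of degree j they determine the relation degrees. *)
Lemma gen_quot_res : (0 < \dim V)%N -> sorted geq B ->
  min_res_quot (gen_ideal V) (nseq (\dim V) j%:Z)
  (rel_degs j B ++ nseq (\dim V - size A) j.+1%:Z).
Proof.
move=> V0 sorted_B; have genE t : gen_ideal V t = if (j <= t)%N then RV V t else 0%VS by [].
have idG : graded_ideal (gen_ideal V).
  move=> t i p; rewrite !genE; case: (leqP j t) => jt; first by rewrite (leqW jt); apply: RV_mulX.
  by rewrite pmem_zero => /eqP ->; rewrite mulr0 pmem0.
have fullG t : (maxn T j <= t)%N -> gen_ideal V t = fullv.
  by rewrite geq_max => /andP[Tt jt]; rewrite genE jt -ancestorE ancestor_full.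
have decG t p : (j <= t)%N -> pmem (gen_ideal V t.+1) p -> pmem (R1mul (gen_ideal V t)) p.
  by move=> jt; rewrite !genE jt (leqW jt) RV_up.
have [m [n [D [S [g [phi [R _ sS _ _]]]]]]] := minres_exists idG fullG.
(* Above j everything is produced by R_1, and below j the ideal is zero while generators are not. *)
have DE l : D l = j.
  apply/eqP; rewrite eqn_leq (mr_gen_bound R decG) leqNgt; apply/negP => Dj.
  have := mr_gen_mem R l; rewrite genE leqNgt Dj pmem_zero.
  by rewrite (negPf (mr_gen_nz R l)).
have Sj i : (j < S i)%N by have [l] := mr_rel_gt R i; rewrite DE.
have dimG t : (n * (t.+1 - j) = \dim (gen_ideal V t) + \sum_(x <- codom S) (t.+1 - x))%N.
  rewrite -(sum_codom S (fun x => (t.+1 - x)%N)) -(mr_dim R) (eq_bigr (fun=> t.+1 - j)%N).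
    by rewrite sum_nat_const card_ord.
  by move=> l _; rewrite DE.
have nE : n = \dim V.
  have := dimG j; rewrite genE leqnn RV_id subSnn muln1 => ->.
  by rewrite big1_seq ?addn0 // => _ /andP[_ /codomP[i ->]]; have := Sj i; lia.
have DX : codom D = nseq (\dim V) j.
  have /all_pred1P -> : all (pred1 j) (codom D) by apply/allP => _ /codomP[l ->] /=; rewrite DE.
  by rewrite size_codom card_ord nE.
pose Y := [seq (j.+1 + b)%N | b <- B] ++ nseq (\dim V - size A) j.+1.
have sorted_Y : sorted geq Y.
  apply: sorted_cat_nseq => //; first by move=> a b c ba cb; apply: leq_trans cb ba.
    by move=> a; apply: leqnn.
    by apply: (homo_sorted _ _ sorted_B) => x y xy; rewrite /geq /= leq_add2l.
  by apply/allP => _ /mapP[b _ ->]; apply: leq_addr.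
have sumY t : (\sum_(y <- Y) (t.+1 - y) =
    \sum_(b <- B) (t - (j + b)) + (\dim V - size A) * (t - j))%N.
  by rewrite /Y big_cat big_map big_nseq iter_addn_0 /= subSS mulnC.
have SE : codom S = Y.
  apply: (sorted_eq (leT := geq)) sS sorted_Y _.
  - by move=> a b c ba cb; apply: leq_trans cb ba.
  - by move=> a b; rewrite andbC; apply: anti_leq.
  apply: (@perm_eq_sums (sumn (codom S) + sumn Y)).
  - by apply/allP => x /(mem_sumn_le) /=; lia.
  - by apply/allP => x /(mem_sumn_le) /=; lia.
  move=> t _; have := dimG t; rewrite nE genE sumY; case: leqP => jt.
    have := ap_dim_upper (t - j); rewrite subnKC // ap_sumA => e1 e2.
    have e3 : (\sum_(b <- B) (t - j - b) = \sum_(b <- B) (t - (j + b)))%N.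
      by apply: eq_bigr => b _; rewrite subnDA.
    have := ap_size_le; rewrite e3 subSn // mulnS in e1 e2 *; rewrite mulnBl => le.
    have := leq_mul2r (t - j) (size A) (\dim V); rewrite le orbT; lia.
  have -> : (t.+1 - j = 0)%N by lia.
  have -> : (t - j = 0)%N by lia.
  rewrite !muln0 dimv0 !add0n => <-; rewrite big1 // => b _; lia.
have -> : nseq (\dim V) j%:Z = map Posz (nseq (\dim V) j) by rewrite map_nseq.
have -> : rel_degs j B ++ nseq (\dim V - size A) j.+1%:Z = map Posz Y.
  by rewrite map_cat map_nseq -map_comp.
apply: (minres_quot_codom R) => //.
rewrite genE leqNgt (leq_trans V0 V_neq_full) pmem_zero; exact: oner_neq0.
Qed.

End Numerics.
End AncestorResolution.

(** * Common factors *)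

Section CommonFactor.
Variable k : fieldType.
Implicit Types p q f h : poly2 k.

(** If x p = a f and y p = b f, then x b = y a, and the common quotient given by [X_syzygy] is p /
    f. *)
Lemma mdvd_mulX f p : (forall i : 'I_2, mdvd f ('X_i * p)) -> mdvd f p.
Proof.
move=> fX; have [a aE] := fX 0; have [b bE] := fX 1.
have [f0|f0] := eqVneq f 0.
  move: aE; rewrite f0 mulr0 => /eqP; rewrite mulf_eq0 (negPf (X_neq0 k 0)) => /eqP ->.
  by exists 0; rewrite mul0r.
have /X_syzygy[q [aq bq]] : 'X_0 * b = 'X_1 * a.
  by apply: (mulIf f0); rewrite -!mulrA -aE -bE; ring.
exists q; apply: (mulfI (X_neq0 k 0)); rewrite aE bq; ring.
Qed.

Lemma mdvd_comb f p q a b : mdvd f p -> mdvd f q -> mdvd f (a * p + b * q).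
Proof. by case=> r -> [s ->]; exists (a * r + b * s); ring. Qed.

Lemma mdvd_dhomog c t f q : f \is c.-homog -> q \is t.-homog -> q != 0 -> mdvd f q ->
  (c <= t)%N /\ exists2 r, r \is (t - c).-homog & q = r * f.
Proof.
move=> hf hq q0 [r qE].
have ct : (c <= t)%N.
  rewrite leqNgt; apply: contra_neqN q0 => tc.
  by rewrite -(pihomog_dE hq) qE (pihomogM0 _ hf tc).
split=> //; exists r => //; have f0 : f != 0.
  by apply: contraNneq q0 => f0; rewrite qE f0 mulr0.
by apply: (mulf_dhomog f0 hf); rewrite subnK // -qE.
Qed.

(* [dim R_{-1} W = 2 dim W - dim R_1 W], so [R_{-1} W] satisfies the hypothesis
   with [n] one smaller, and [W = R_1 R_{-1} W]. *)
Lemma principal_space n t (W : {vspace Rform k t}) :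
  \dim W = n.+1 -> \dim (R1mul W) = n.+2 ->
  (n <= t)%N /\ exists f, [/\ f \is (t - n).-homog, f != 0 &
    forall p, pmem W p <-> exists2 h, h \is n.-homog & p = h * f].
Proof.
elim: n t W => [|n IH] t W dW dRW.
  have W0 : vpick W != 0 by rewrite vpick0 -dimv_eq0 dW.
  have WE : W = <[vpick W]>%VS.
    apply/eqP; rewrite eq_sym eqEdim -memvE memv_pick dW dim_vline W0 //.
  split=> //; exists (vpick W : poly2 k); split.
  - by rewrite subn0; apply: dhomog_is_dhomog.
  - by apply: contra W0 => /eqP e; apply/eqP/val_inj.
  move=> p; split=> [/pmemP[q]|[h /dhomog0E -> ->]].
    rewrite WE => /vlineP[a ->] ->; exists a%:MP; last by rewrite mul_mpolyC -WE.
    by rewrite -[_%:MP]mulr1 mul_mpolyC dhomogZ ?dhomog1.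
  by rewrite mul_mpolyC pmemZ // pmem_val memv_pick.
case: t W dW dRW => [|t] W dW dRW; first by have := dim_Rform_le W; lia.
have dW' : \dim (R1colon W) = n.+1 by have := dim_R1mul W; lia.
have sub : (R1mul (R1colon W) <= W)%VS.
  apply/pmem_sub => p /pmem_R1mul[a [b [aW bW ->]]].
  move: aW bW; rewrite !pmem_R1colon => /and3P[_ a0 _] /and3P[_ _ b1].
  exact: pmemD.
have dRW' : \dim (R1mul (R1colon W)) = n.+2.
  have := dimvS sub; have := dim_R1mul_gt (U := R1colon W); rewrite dW dW'; lia.
have WE : R1mul (R1colon W) = W by apply/eqP; rewrite eqEdim sub dRW' dW leqnn.
have [nt [f [hf f0 fE]]] := IH _ _ dW' dRW'.
split=> //; exists f; split=> // p; rewrite -{1}WE; split=> [/pmem_R1mul|[h]].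
  case=> _ [_ [/fE[a ha ->] /fE[b hb ->] ->]].
  by exists ('X_0 * a + 'X_1 * b); [apply: rpredD; apply: dhomogXM | ring].
case/dhomog_split=> a [b [ha hb ->]] ->; apply/pmem_R1mul.
exists (a * f), (b * f); split; [apply/fE | apply/fE | ring].
  by exists a.
by exists b.
Qed.

Section CommonDivisor.
Variables (j : nat) (V : {vspace Rform k j}).

Lemma mdvd_RV_up f s : (forall v, v \in V -> mdvd f v) -> (j <= s)%N ->
  forall p, pmem (RV V s) p -> mdvd f p.
Proof.
move=> fV js; rewrite -(subnKC js); elim: (s - j)%N => [|i IH] p.
  by rewrite addn0 RV_id => /pmemP[v /fV + ->].
rewrite addnS RV_up ?leq_addr // => /pmem_R1mul[a [b [/IH fa /IH fb ->]]].
exact: mdvd_comb.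
Qed.

Lemma mdvd_RV_down f s : (forall p, pmem (RV V s) p -> mdvd f p) ->
  forall t, (t <= s)%N -> forall p, pmem (RV V t) p -> mdvd f p.
Proof.
move=> fs t ts; rewrite -(subKn ts); elim: (s - t)%N => [|i IH] p.
  by rewrite subn0; apply: fs.
(* Once i reaches s, the truncated difference stays at 0 and the step is void. *)
case: (leqP s i) => [si|ilt].
  have -> : (s - i.+1 = s - i)%N by lia.
  exact: IH.
move=> pV; apply: mdvd_mulX => l; apply: IH.
have -> : (s - i = (s - i.+1).+1)%N by lia.
exact: RV_mulX.
Qed.

Lemma mdvd_RV f s : (forall v, v \in V -> mdvd f v) ->
  forall p, pmem (RV V s) p -> mdvd f p.
Proof.
move=> fV; case: (leqP j s) => js; first exact: mdvd_RV_up.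
apply: (mdvd_RV_down (s := j)) (ltnW js); exact: mdvd_RV_up.
Qed.

(** For large t the piece R_{t-j} V has codimension c and grows by one, so [principal_space] makes
    it f R_{t-c} with f of degree c. Divisibility by f, and by any common divisor h, passes between
    this piece and V. *)
Lemma gcd_exists c N : (forall t, (N <= t)%N -> (\dim (RV V t) + c = t.+1)%N) ->
  exists f, is_gcd f V /\ f \is c.-homog.
Proof.
move=> dimV; pose t := maxn N j; have Nt : (N <= t)%N := leq_maxl _ _.
have jt : (j <= t)%N := leq_maxr _ _.
have dt := dimV _ Nt; have := dimV _ (leqW Nt); rewrite RV_up // => dt1.
(* A zero piece would stay zero, making c equal to both t + 1 and t + 2. *)
have t0 : (0 < \dim (RV V t))%N.
  rewrite lt0n; apply/eqP => d0; have U0 : RV V t = 0%VS by apply/eqP; rewrite -dimv_eq0 d0.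
  by move: dt1; rewrite U0 /R1mul !limg0 addv0 dimv0; lia.
have [|| nt [f [hf f0 fE]]] := @principal_space (t - c) t (RV V t); [lia | lia |].
exists f; split; last by have -> : c = (t - (t - c))%N by lia.
split=> [v vV|h hV].
  apply: (mdvd_RV_down (s := t)) jt _ _; last by rewrite RV_id pmem_val.
  by move=> p /fE[q _ ->]; exists q.
have hft := mdvd_RV_up hV jt.
(* From h dividing m f for all m of degree t - c, [mdvd_mulX] lowers the degree of m by one at a
   time, down to m = 1. *)
suff hm i : (i <= t - c)%N -> forall m, m \is (t - c - i).-homog -> mdvd h (m * f).
  by have := hm _ (leqnn _) 1; rewrite subnn mul1r; apply; apply: dhomog1.
elim: i => [_ m|i IH ilt m]; first by rewrite subn0 => mh; apply/hft/fE; exists m.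
move=> mh; apply: mdvd_mulX => l; rewrite mulrA; apply: IH; first exact: ltnW.
have -> : (t - c - i = (t - c - i.+1).+1)%N by lia.
exact: dhomogXM.
Qed.

(** * Dividing V by a common factor *)

Section Quotient.
Variables (c : nat) (f : poly2 k).
Hypotheses (hf : f \is c.-homog) (f0 : f != 0) (fV : forall v, v \in V -> mdvd f v).

Lemma RV_low_degree t : (t < c)%N -> RV V t = 0%VS.
Proof.
move=> tc; apply: pmem_eq => p; rewrite pmem_zero; apply/idP/eqP => [pV|->]; last exact: pmem0.
apply/eqP; apply: contraTT tc => p0; rewrite -leqNgt.
by have [] := mdvd_dhomog hf (pmem_homog pV) p0 (mdvd_RV fV pV).
Qed.

Variables (j' : nat) (V' : {vspace Rform k j'}).
Hypothesis jE : (j' + c)%N = j.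
Hypothesis V'E : forall p, pmem V' p = (p \is j'.-homog) && pmem V (p * f).

(** Upwards, the elements of R_i V are multiples of f, and quotients by f are unique. Downwards,
    testing products with x and y commutes with multiplication by f. *)
Lemma pmem_RV_quotient t p :
  pmem (RV V' t) p = (p \is t.-homog) && pmem (RV V (t + c)) (p * f).
Proof.
case: (leqP j' t) => [jt|/ltnW tj].
  rewrite -(subnKC jt); elim: (t - j')%N p => [|i IH] p; first by rewrite addn0 RV_id jE RV_id.
  rewrite addnS RV_up ?leq_addr // addSn RV_up; last lia.
  apply/pmem_R1mul/andP => [[a [b [aV bV ->]]]|[hp /pmem_R1mul[a [b [aV bV pE]]]]].
    move: aV bV; rewrite !IH => /andP[ha aV] /andP[hb bV].
    split; first by rewrite rpredD // dhomogXM.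
    by apply/pmem_R1mul; exists (a * f), (b * f); split=> //; ring.
  have quot q : pmem (RV V (j' + i + c)) q -> exists2 r, pmem (RV V' (j' + i)) r & q = r * f.
    move=> qV; have [->|q0] := eqVneq q 0; first by exists 0; rewrite ?pmem0 ?mul0r.
    have [_ [r hr qE]] := mdvd_dhomog hf (pmem_homog qV) q0 (mdvd_RV fV qV).
    by exists r; rewrite // IH -qE qV andbT; rewrite addnK in hr.
  have [a' aV' aE] := quot _ aV; have [b' bV' bE] := quot _ bV.
  exists a', b'; split=> //; apply: (mulIf f0); rewrite pE aE bE; ring.
rewrite -(subKn tj); elim: (j' - t)%N p => [|i IH] p; first by rewrite subn0 RV_id jE RV_id.
case: (leqP j' i) => [ji|ij].
  have -> : (j' - i.+1 = j' - i)%N by lia.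
  exact: IH.
have tE : (j' - i = (j' - i.+1).+1)%N by lia.
rewrite tE in IH; rewrite RV_down ?pmem_R1colon; last lia.
rewrite [in RHS]RV_down ?pmem_R1colon; last lia.
rewrite -addSn !IH !mulrA.
have [hp|//] := boolP (p \is (j' - i.+1).-homog).
by rewrite !dhomogXM // (dhomogM hp hf).
Qed.

(** Multiplication by f is the isomorphism; it is onto because f divides every element of the
    target. *)
Lemma dim_RV_quotient t : \dim (RV V' t) = \dim (RV V (t + c)).
Proof.
have hf' : f \is (t + c - t).-homog by rewrite addKn.
have mulfE (q : Rform k t) : mulform t (t + c) f q = f * (q : poly2 k) :> poly2 k.
  by apply: mulformE => //; apply: leq_addr.
have inj : lker (mulform t (t + c) f) == 0%VS.
  apply/lker0P => a b /(congr1 (fun x : Rform k _ => x : poly2 k)).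
  by rewrite !mulfE => /(mulfI f0)/val_inj.
rewrite -(limg_dim_eq (f := mulform t (t + c) f) (U := RV V' t)); last by rewrite (eqP inj) capv0.
congr (\dim _); apply: pmem_eq => p; apply/pmemP/idP => [[_ /memv_imgP[q qV ->] ->]|pV].
  by move: qV; rewrite -pmem_val pmem_RV_quotient mulfE mulrC => /andP[].
have [r rV pE] : exists2 r, pmem (RV V' t) r & p = r * f.
  have [->|p0] := eqVneq p 0; first by exists 0; rewrite ?pmem0 ?mul0r.
  have [_ [r hr pE]] := mdvd_dhomog hf (pmem_homog pV) p0 (mdvd_RV fV pV).
  by exists r; rewrite // pmem_RV_quotient -pE pV andbT; rewrite addnK in hr.
have [q qV qE] := pmemP _ _ rV.
by exists (mulform t (t + c) f q); [rewrite memv_img | rewrite mulfE -qE mulrC].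
Qed.

End Quotient.

Lemma pmem_colon_form c f p : f \is c.-homog -> (c <= j)%N ->
  pmem (colon_form c f V) p = (p \is (j - c).-homog) && pmem V (p * f).
Proof.
move=> hf cj; have hf' : f \is (j - (j - c)).-homog by rewrite subKn.
have [hp|hp] /= := boolP (p \is (j - c).-homog); last by rewrite /pmem (negPf hp).
have -> : p = indhomog (j - c) p :> poly2 k by rewrite indhomogK.
by rewrite pmem_val -memv_preim -pmem_val mulformE ?leq_subr // mulrC.
Qed.

End CommonDivisor.
End CommonFactor.

(** * Numerical consequences *)

Lemma sumn_succ s : sumn (map succn s) = (sumn s + size s)%N.
Proof. by elim: s => //= x s ->; lia. Qed.

Section HilbertNumerics.
Variables (k : fieldType) (d j c tau : nat) (H : nat -> nat) (V : {vspace Rform k j}).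
Hypotheses (V_dim : \dim V = d) (d_le_j : (d <= j)%N).
Hypothesis V_hilb : forall i, (\dim (RV V i) + H i = i.+1)%N.
Hypothesis tau_def : tau%:Z = eH H j + 1.

Lemma dim_RV0 : \dim (RV V 0) = 0%N.
Proof.
have dj : (\dim V <= j)%N by rewrite V_dim.
apply/eqP; rewrite dimv_eq0 -subv0; apply/pmem_sub => p pV; rewrite pmem_zero.
have pE := dhomog0E (pmem_homog pV); rewrite pE mpolyC_eq0.
apply: contraNT (ancestor_proper dj) => p0; rewrite ancestorE.
have -> : 1 = (p@_0%MM)^-1 *: p :> poly2 k by rewrite {2}pE -mul_mpolyC -mpolyCM mulVf.
exact: pmemZ.
Qed.

(** For W = R_{t-j} V, [dim_R1mul] turns dim R_1 W - dim W into dim W - dim R_{-1} W, and R_{-1} W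
    is the next lower piece. In degree 0 both sides vanish, by the convention e_0 = -1. *)
Lemma tauV_RV t : (t <= j)%N -> tauV (RV V t) = eH H t + 1.
Proof.
move=> tj; rewrite /tauV (RV_up (RV V t) (leqnn t)) RV_id.
case: t tj => [|t] tj; first by rewrite dim_R1mul0 dim_RV0.
have := dim_R1mul (RV V t.+1); rewrite -RV_down // /eH.
have := V_hilb t; have := V_hilb t.+1; lia.
Qed.

(** Both cases at once: V' is V when c = 0 and V : f when c > 0. The partitions belong to V', the
    Hilbert function to V. *)
Variables (j' : nat) (V' : {vspace Rform k j'}) (T : nat) (A B : seq nat).
Hypothesis jE : (j' + c)%N = j.
Hypothesis dimE : forall t, \dim (RV V' t) = \dim (RV V (t + c)).
Hypothesis low : forall t, (t < c)%N -> \dim (RV V t) = 0%N.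
Hypothesis full : forall t, (T <= t)%N -> \dim (RV V' t) = t.+1.
Hypothesis ap : ancestor_partitions V' A B.

Lemma dim_quotient : \dim V' = d.
Proof. by rewrite -[in LHS](RV_id V') dimE jE RV_id. Qed.

Lemma num_sumA : sumn A = d.
Proof. by rewrite (ap_sumA ap) dim_quotient. Qed.

Lemma num_A_ge1 : all (leq 1) A.
Proof. by apply: sub_all (ap_A ap) => a /andP[]. Qed.

Lemma num_A_le a : a \in A -> (a <= j'.+1)%N.
Proof. by move/(allP (ap_A ap))/andP => []. Qed.

(** For i > j' the degree j - i is below c, where V has no piece; the sum vanishes too since a ≤ j'
    + 1. *)
Lemma num_dim i : (i <= j)%N -> \dim (RV V (j - i)) = (\sum_(a <- A) (a - i))%N.
Proof.
move=> ij; case: (leqP i j') => [ij'|ij'].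
  by rewrite -(ap_dim_lower ap ij') dimE; congr (\dim (RV V _)); lia.
rewrite low; last by lia.
by rewrite big1_seq // => a /andP[_ /num_A_le]; lia.
Qed.

Lemma num_countA i : (1 <= i <= j.+1)%N ->
  (count (fun a => i <= a)%N A)%:Z = eH H (j.+1 - i) + 1.
Proof.
case: i => // i /andP[_]; rewrite ltnS subSS => ij.
have := num_dim ij; rewrite sum_subSr.
move: ij; rewrite leq_eqVlt => /predU1P[->|ij].
  rewrite subnn dim_RV0 /=; lia.
rewrite -num_dim // (_ : j - i = (j - i.+1).+1)%N; last by lia.
rewrite /eH; have := V_hilb (j - i.+1).+1; have := V_hilb (j - i.+1); lia.
Qed.

Lemma num_countA_gt i : (j.+1 < i)%N -> count (fun a => i <= a)%N A = 0%N.
Proof.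
move=> ji; apply/eqP; rewrite -leqn0 leqNgt -has_count; apply/hasPn => a /num_A_le; lia.
Qed.

Lemma num_sizeA : size A = tau.
Proof.
have := num_countA (i := 1); rewrite subn1 /= => /(_ isT).
by rewrite -tau_def; have := num_A_ge1; rewrite all_count => /eqP -> [].
Qed.

Lemma num_sizeB : size B = (tau - 1)%N.
Proof. by have [sz _] := ap_sizes full ap; rewrite -num_sizeA sz subn1. Qed.

Lemma num_sumB : sumn B = (j.+1 - d - c)%N.
Proof. by have [_] := ap_sizes full ap; rewrite num_sumA; lia. Qed.

Lemma num_hilb i : H (j + i)%N = (c + \sum_(b <- B) (b - i))%N.
Proof.
have := ap_hilb_upper full ap i; rewrite dimE addnAC jE; have := V_hilb (j + i); lia.
Qed.

Lemma num_countB i : (1 <= i)%N -> (count (fun b => i <= b)%N B)%:Z = eH H (j + i).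
Proof.
by case: i => // i _; rewrite addnS /eH -addnS !num_hilb [in RHS]sum_subSr; lia.
Qed.

Lemma num_tau_le : (tau <= d)%N.
Proof. by rewrite -num_sizeA -dim_quotient; apply: ap_size_le ap. Qed.

(** R_1 V' has dimension d + tau and lies in a space of dimension j' + 2. Hence the number of ones
    appended in [partC] is not truncated; [num_tau_le] does the same for [partD]. *)
Lemma num_d_tau_le : (d + tau <= j.+2)%N.
Proof.
have := ap_dimS ap; rewrite dim_quotient num_sizeA => e.
have := dim_Rform_le (RV V' j'.+1); rewrite e; lia.
Qed.

Lemma num_tau_gt0 : (0 < tau)%N.
Proof. by have [sz _] := ap_sizes full ap; rewrite -num_sizeA sz. Qed.

Lemma count_partC i : (0 < i)%N ->
  count (fun a => i.+1 <= a)%N (partC d j tau A) = count (fun a => i <= a)%N A.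
Proof.
move=> i0; rewrite /partC count_cat count_map count_nseq /= ltnNge i0 mul0n addn0.
exact: eq_count.
Qed.

Lemma count_partD i : (0 < i)%N ->
  count (fun a => i.+1 <= a)%N (partD d tau B) = count (fun a => i <= a)%N B.
Proof.
move=> i0; rewrite /partD count_cat count_map count_nseq /= ltnNge i0 mul0n addn0.
exact: eq_count.
Qed.

Lemma num_partA i : (1 <= i <= j.+1)%N ->
  (part (dualp A) i)%:Z = tauV (RV V (j.+1 - i)) /\
  tauV (RV V (j.+1 - i)) = eH H (j.+1 - i) + 1.
Proof.
move=> ij; case/andP: (ij) => i0 _; rewrite part_dualp // num_countA // tauV_RV //; lia.
Qed.

Lemma num_partA1 : part (dualp A) 1 = tau.
Proof.
by rewrite part_dualp //; have := num_A_ge1; rewrite all_count num_sizeA => /eqP.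
Qed.

Lemma num_partA_gt i : (j.+1 < i)%N -> part (dualp A) i = 0%N.
Proof. by move=> ji; rewrite part_dualp ?num_countA_gt //; lia. Qed.

Lemma num_partB i : (1 <= i)%N -> (part (dualp B) i)%:Z = eH H (j + i).
Proof. by move=> i1; rewrite part_dualp // num_countB. Qed.

Lemma num_partC1 : part (dualp (partC d j tau A)) 1 = (j.+2 - d)%N.
Proof.
have : all (leq 1) (partC d j tau A).
  rewrite all_cat; apply/andP; split; first by apply/allP => _ /mapP[a _ ->].
  by apply/allP => _ /nseqP[-> _].
rewrite part_dualp // all_count => /eqP ->.
rewrite /partC size_cat size_map size_nseq num_sizeA; have := num_d_tau_le; lia.
Qed.

Lemma num_partC i : (i <= j)%N ->
  (part (dualp (partC d j tau A)) i.+2)%:Z = tauV (RV V (j - i)).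
Proof.
move=> ij; rewrite part_dualp // count_partC // num_countA //.
by rewrite subSS tauV_RV ?leq_subr.
Qed.

Lemma num_partC_gt i : (j < i)%N -> part (dualp (partC d j tau A)) i.+2 = 0%N.
Proof. by move=> ji; rewrite part_dualp // count_partC // num_countA_gt. Qed.

Lemma num_partD1 : part (dualp (partD d tau B)) 1 = (d - 1)%N.
Proof.
have : all (leq 1) (partD d tau B).
  rewrite all_cat; apply/andP; split; first by apply/allP => _ /mapP[a _ ->].
  by apply/allP => _ /nseqP[-> _].
rewrite part_dualp // all_count => /eqP ->.
rewrite /partD size_cat size_map size_nseq num_sizeB.
have := num_tau_le; have := num_tau_gt0; lia.
Qed.

Lemma num_partD i : (1 <= i)%N -> (part (dualp (partD d tau B)) i.+1)%:Z = eH H (j + i).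
Proof. by move=> i1; rewrite part_dualp // count_partD // num_countB. Qed.

Lemma num_sumC : sumn (partC d j tau A) = j.+2.
Proof.
rewrite /partC sumn_cat sumn_succ sumn_nseq num_sumA num_sizeA.
by have := num_d_tau_le; lia.
Qed.

Lemma num_sumD : c = 0%N -> sumn (partD d tau B) = j.
Proof.
move=> c0; rewrite /partD sumn_cat sumn_succ sumn_nseq num_sumB num_sizeB.
have := num_tau_le; have := num_tau_gt0; lia.
Qed.

End HilbertNumerics.

(** The partitions are those of any minimal resolution of the required shape, not of a chosen one;
    the first conjunct guarantees that such a resolution exists. *)
Theorem lemma2p23 (k : fieldType) (d j c tau : nat) (H : nat -> nat)
    (V : {vspace Rform k j})
    (d_gt0 : (0 < d)%N) (d_le_j : (d <= j)%N)
    (H_acc : acceptable d j c H)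
    (V_dim : \dim V = d)
    (V_hilb : forall i, hilb_quot (ancestor V) i = H i)
    (tau_def : tau%:Z = eH H j + 1) :
  (exists A B, assoc_partitions c V A B) /\
  (forall A B, assoc_partitions c V A B ->
    let C := partC d j tau A in
    let D := partD d tau B in
    (c = 0%N ->
      (* resolutions of R/V^bar, R/L(V) and R/(V) *)
      size A = tau /\ size B = (tau - 1)%N /\
      min_res_quot (ancestor V) (gen_degs j A) (rel_degs j B) /\
      min_res_quot (level_ideal V)
        (gen_degs j A ++ nseq (j.+2 - d - tau) j.+1%:Z)
        (nseq (j.+1 - d) j.+2%:Z) /\
      min_res_quot (gen_ideal V)
        (nseq d j%:Z)
        (rel_degs j B ++ nseq (d - tau) j.+1%:Z) /\
      (* A and its dual *)
      sumn A = d /\ all (leq 1) A /\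
      sumn (dualp A) = d /\ part (dualp A) 1 = tau /\
      (forall i, (1 <= i <= j.+1)%N ->
         (part (dualp A) i)%:Z = tauV (RV V (j.+1 - i)) /\
         tauV (RV V (j.+1 - i)) = eH H (j.+1 - i) + 1) /\
      (forall i, (j.+1 < i)%N -> part (dualp A) i = 0%N) /\
      (* B and its dual *)
      sumn B = (j.+1 - d)%N /\ all (leq 1) B /\
      sumn (dualp B) = (j.+1 - d)%N /\
      (forall i, (1 <= i)%N -> (part (dualp B) i)%:Z = eH H (j + i)) /\
      (* dimensions; |a - i|^+ is truncated subtraction *)
      (forall i, (i <= j)%N ->
         \dim (ancestor V (j - i)%N) = (\sum_(a <- A) (a - i))%N) /\
      (forall i, H (j + i)%N = (\sum_(b <- B) (b - i))%N) /\
      (* the duals of C and D *)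
      sumn (dualp C) = j.+2 /\ part (dualp C) 1 = (j.+2 - d)%N /\
      (forall i, (i <= j)%N ->
         (part (dualp C) i.+2)%:Z = tauV (RV V (j - i))) /\
      (forall i, (j < i)%N -> part (dualp C) i.+2 = 0%N) /\
      sumn (dualp D) = j /\ part (dualp D) 1 = (d - 1)%N /\
      (forall i, (1 <= i)%N -> (part (dualp D) i.+1)%:Z = eH H (j + i))) /\
    ((0 < c)%N ->
      (* A and its dual *)
      size A = tau /\ sumn A = d /\ all (leq 1) A /\
      sumn (dualp A) = d /\ part (dualp A) 1 = tau /\
      (forall i, (1 <= i <= j.+1)%N ->
         (part (dualp A) i)%:Z = tauV (RV V (j.+1 - i)) /\
         tauV (RV V (j.+1 - i)) = eH H (j.+1 - i) + 1) /\
      (forall i, (j.+1 < i)%N -> part (dualp A) i = 0%N) /\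
      (forall i, (i <= j)%N ->
         \dim (ancestor V (j - i)%N) = (\sum_(a <- A) (a - i))%N) /\
      (* B and its dual *)
      size B = (tau - 1)%N /\ sumn B = (j.+1 - d - c)%N /\ all (leq 1) B /\
      (forall i, (1 <= i)%N -> (part (dualp B) i)%:Z = eH H (j + i)) /\
      (forall i, H (j + i)%N = (c + \sum_(b <- B) (b - i))%N) /\
      (* the duals of C and D *)
      part (dualp C) 1 = (j.+2 - d)%N /\
      (forall i, (i <= j)%N ->
         (part (dualp C) i.+2)%:Z = tauV (RV V (j - i))) /\
      (forall i, (j < i)%N -> part (dualp C) i.+2 = 0%N) /\
      part (dualp D) 1 = (d - 1)%N /\
      (forall i, (1 <= i)%N -> (part (dualp D) i.+1)%:Z = eH H (j + i)))).
Proof.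
have dimH i : (\dim (RV V i) + H i = i.+1)%N.
  rewrite -V_hilb /hilb_quot ancestorE dim_Rform subnKC //; exact: dim_Rform_le.
have [N limH] := acc_lim H_acc.
have dimN t : (N <= t)%N -> (\dim (RV V t) + c = t.+1)%N.
  by move=> Nt; rewrite -(limH _ Nt).
have dj : (\dim V <= j)%N by rewrite V_dim.
(* Proved for an arbitrary greatest common divisor, since the one behind given A and B need not be
   the one constructed by [gcd_exists]. *)
have quot f : is_gcd f V -> f \is c.-homog ->
    [/\ f != 0, (c <= j)%N, forall t, \dim (RV (colon_form c f V) t) = \dim (RV V (t + c)),
        forall t, (t < c)%N -> \dim (RV V t) = 0%N &
        forall t, (N <= t)%N -> \dim (RV (colon_form c f V) t) = t.+1].
  move=> [fV _] hf.
  have v0 : (vpick V : poly2 k) != 0.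
    have : vpick V != 0 by rewrite vpick0 -dimv_eq0 V_dim; lia.
    by apply: contra => /eqP e; apply/eqP/val_inj.
  have fv := fV _ (memv_pick V).
  have f0 : f != 0.
    by case: fv => r e; apply: contraNneq v0 => f0; rewrite e f0 mulr0.
  have [cj _] := mdvd_dhomog hf (dhomog_is_dhomog (vpick V)) v0 fv.
  have dimq t := dim_RV_quotient hf f0 fV (subnK cj) (fun p => pmem_colon_form V p hf cj) t.
  split=> // t tN; first by rewrite (RV_low_degree hf fV tN) dimv0.
  by rewrite dimq; have := dimN (t + c)%N; lia.
split.
  have [c0|c0] := posnP c.
    have full t : (N <= t)%N -> \dim (RV V t) = t.+1.
      by move=> /dimN; rewrite c0 addn0.
    have [A [B [sA sB res]]] := ancestor_minres_exists full.
    by exists A, B; split; rewrite // c0 eqxx.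
  have [f [gf hf]] := gcd_exists dimN.
  have [f0 cj dimq low full] := quot f gf hf.
  have [A [B [sA sB res]]] := ancestor_minres_exists full.
  exists A, B; split=> //; rewrite eqn0Ngt c0 /=.
  by exists f.
move=> A B [sA sB] res C D; split=> c0.
  move: res; rewrite c0 eqxx => res.
  have full t : (N <= t)%N -> \dim (RV V t) = t.+1.
    by move=> /dimN; rewrite c0 addn0.
  have ap := minres_ancestor_partitions res.
  (* With c = 0 the numerical lemmas apply with V' = V. *)
  have jE : (j + c)%N = j by rewrite c0 addn0.
  have dimE t : \dim (RV V t) = \dim (RV V (t + c)) by rewrite c0 addn0.
  have low t : (t < c)%N -> \dim (RV V t) = 0%N by rewrite c0.
  have szA : size A = tau by apply: num_sizeA; eassumption.
  split; first exact: szA.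
  split; first by apply: num_sizeB; eassumption.
  split; first by apply: ancestor_quot_res.
  split; first by have := level_quot_res ap dj sA; rewrite V_dim szA.
  split; first by have := gen_quot_res full ap dj; rewrite V_dim szA; apply.
  split; first by apply: num_sumA; eassumption.
  split; first by apply: num_A_ge1; eassumption.
  split; first by rewrite sumn_dualp; apply: num_sumA; eassumption.
  split; first by apply: num_partA1; eassumption.
  split; first by apply: num_partA; eassumption.
  split; first by apply: num_partA_gt; eassumption.
  have sumB : sumn B = (j.+1 - d)%N.
    by rewrite -[RHS]subn0 -c0; apply: num_sumB; eassumption.
  split; first exact: sumB.
  split; first exact: ap_B ap.
  split; first by rewrite sumn_dualp.
  split; first by apply: num_partB; eassumption.
  split; first by move=> i ij; rewrite ancestorE; apply: num_dim ij; eassumption.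
  have hilb i : H (j + i)%N = (c + \sum_(b <- B) (b - i))%N by apply: num_hilb; eassumption.
  split; first by move=> i; rewrite hilb c0.
  split; first by rewrite sumn_dualp; apply: num_sumC; eassumption.
  split; first by apply: num_partC1; eassumption.
  split; first by apply: num_partC; eassumption.
  split; first by apply: num_partC_gt; eassumption.
  split; first by rewrite sumn_dualp; apply: num_sumD; eassumption.
  split; first by apply: num_partD1; eassumption.
  by apply: num_partD; eassumption.
move: res; rewrite eqn0Ngt c0 /= => -[f [gf hf res]].
have [f0 cj dimq low full] := quot f gf hf.
have ap := minres_ancestor_partitions res.
have {c0} jE := subnK cj; clear cj.
split; first by apply: num_sizeA; eassumption.
split; first by apply: num_sumA; eassumption.
split; first by apply: num_A_ge1; eassumption.
split; first by rewrite sumn_dualp; apply: num_sumA; eassumption.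
split; first by apply: num_partA1; eassumption.
split; first by apply: num_partA; eassumption.
split; first by apply: num_partA_gt; eassumption.
split; first by move=> i ij; rewrite ancestorE; apply: num_dim ij; eassumption.
split; first by apply: num_sizeB; eassumption.
split; first by apply: num_sumB; eassumption.
split; first exact: ap_B ap.
split; first by apply: num_partB; eassumption.
split; first by apply: num_hilb; eassumption.
split; first by apply: num_partC1; eassumption.
split; first by apply: num_partC; eassumption.
split; first by apply: num_partC_gt; eassumption.
split; first by apply: num_partD1; eassumption.
by apply: num_partD; eassumption.
Qed.
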